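(* There exists a singular measure $\mu=\sum_{n\in\mathbb{N}}c_n\delta_{\tau_n}$ on $\mathbb{T}$, with $c_n>0$, $\sum_nc_n<\infty$ and $\tau_n$ pairwise distinct points of $\mathbb{T}$, such that $S_\mu$ is a factor of $\mathcal{D}$ with the following property: there does not exist a subset $C\subset\mathbb{N}$ such that (1) $\{\tau_n:n\in C\}$ is contained in a Carleson set, and (2) $\displaystyle\sum_{n\in\mathbb{N}\setminus C}\frac{1}{\log\left(1+\frac{1}{c_n}\right)}<\infty$.
   Context: $\mathbb{D}$ is the open unit disc in $\mathbb{C}$, $\mathbb{T}$ the unit circle, $\delta_\tau$ the unit point mass at $\tau$. The Dirichlet space $\mathcal{D}$ is the space of analytic functions $f$ on $\mathbb{D}$ with $\int_{\mathbb{D}}|f'|^2\,dA<\infty$ ($A$ normalized area measure); it is contained in the Hardy space $H^2$. For a positive finite Borel measure $\mu$ on $\mathbb{T}$ singular with respect to Lebesgue measure, $S_\mu(z)=\exp\left(-\int_{\mathbb{T}}\frac{w+z}{w-z}\,d\mu(w)\right)$. An inner function $I$ is a factor of $\mathcal{D}$ if it occurs as the inner factor of some non-zero function in $\mathcal{D}$, i.e. if $IH^2\cap\mathcal{D}\neq(0)$. A compact set $E\subset\mathbb{T}$ is a Carleson set if $\int_{\mathbb{T}}\log\left(\frac{1}{\operatorname{dist}(z,E)}\right)|dz|<\infty$. *)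

(* Defs.v *)
From HB Require Import structures.
From mathcomp Require Import all_boot all_order all_algebra.
From mathcomp Require Import all_classical all_reals all_analysis.
From mathcomp.real_closed Require Import complex.

Set Implicit Arguments.
Unset Strict Implicit.
Unset Printing Implicit Defensive.

Import Order.TTheory GRing.Theory Num.Theory.
Import numFieldNormedType.Exports.
Import ComplexField Normc.

Local Open Scope classical_set_scope.
Local Open Scope ring_scope.
Local Open Scope complex_scope.

(* The norm topology on the complex field, as a normed space over itself:
   [derivable f z 1] then means complex differentiability at [z], and
   [derive1 f z] is the complex derivative. *)
HB.instance Definition _ (R : realType) := NormedModule.copy R[i] R[i]^o.

Definition borelC (R : realType) : Type := g_sigma_algebraType (@open R[i]).
HB.instance Definition _ (R : realType) := Measurable.on (borelC R).

Definition disc (R : realType) : set R[i] := [set z | normc z < 1].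

Definition circle (R : realType) : set R[i] := [set z | normc z = 1].

Definition cis (R : realType) (t : R) : R[i] := cos t +i* sin t.

Definition cexp (R : realType) (z : R[i]) : R[i] :=
  (expR (complex.Re z))%:C * cis (complex.Im z).

Definition analytic_on_disc (R : realType) (f : R[i] -> R[i]) : Prop :=
  forall z, disc z -> derivable f z 1.

(* $\int_{\mathbb D} F \, dA$, with $dA = \pi^{-1} dx\,dy$. *)
Definition area_integral (R : realType) (F : R[i] -> \bar R) : \bar R :=
  ((pi^-1)%:E *
   \int[(@lebesgue_measure R \x @lebesgue_measure R)%E]_(p in
     [set p | disc (p.1 +i* p.2)]) F (p.1 +i* p.2))%E.

(* $\int_{\mathbb T} F(z) \, |dz|$ *)
Definition circle_integral (R : realType) (F : R[i] -> \bar R) : \bar R :=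
  (\int[@lebesgue_measure R]_(t in `[0%R, (2 * pi)%R]) F (cis t))%E.

Definition Dirichlet (R : realType) : set (R[i] -> R[i]) :=
  [set f | analytic_on_disc f /\
    (area_integral (fun z => (normc (derive1 f z) ^+ 2)%:E) < +oo)%E].

Definition Hardy2 (R : realType) : set (R[i] -> R[i]) :=
  [set f | analytic_on_disc f /\
    (ereal_sup [set ((2 * pi)^-1)%:E *
       circle_integral (fun z => (normc (f (r%:C * z)) ^+ 2)%:E)
       | r in [set r : R | (0 <= r < 1)%R]] < +oo)%E].

Definition inner (R : realType) (I : R[i] -> R[i]) : Prop :=
  [/\ analytic_on_disc I,
      forall z, disc z -> normc (I z) <= 1 &
      {ae @lebesgue_measure R, forall t : R, exists l : R[i],
         normc l = 1 /\ I (r%:C * cis t) @[r --> (1 : R)^'-] --> l}].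

(* The inner function [I] satisfies $I H^2 \cap \mathcal D \neq (0)$. Elements of
   function spaces on the disc are total functions of which only the values on
   the disc matter. *)
Definition factor_of_Dirichlet (R : realType) (I : R[i] -> R[i]) : Prop :=
  inner I /\
  exists g : R[i] -> R[i],
    [/\ @Hardy2 R g, @Dirichlet R (fun z => I z * g z) &
        exists2 z, disc z & I z * g z != 0].

(* $\int_D f \, d\mu$ for complex-valued [f], by real and imaginary parts *)
Definition cintegral (R : realType) (mu : {measure set (borelC R) -> \bar R})
    (D : set (borelC R)) (f : borelC R -> R[i]) : R[i] :=
  (\int[mu]_(w in D) complex.Re (f w)) +i* (\int[mu]_(w in D) complex.Im (f w)).

Definition singular_inner (R : realType) (mu : {measure set (borelC R) -> \bar R})
    (z : R[i]) : R[i] :=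
  cexp (- cintegral mu (@circle R)
            (fun w => ((w : R[i]) + z) / ((w : R[i]) - z))).

(* A finite Borel measure on the plane is regarded as a measure on the circle
   when it is carried by the circle; it is singular when it is moreover carried
   by a set of zero arc length. *)
Definition singular_on_circle (R : realType)
    (mu : {finite_measure set (borelC R) -> \bar R}) : Prop :=
  mu (~` (@circle R)) = 0%E /\
  exists N : set (borelC R),
    [/\ measurable N, mu (~` N) = 0%E &
        @lebesgue_measure R (`[0, 2 * pi] `&` [set t : R | N (cis t)]) = 0%E].

Definition edistC (R : realType) (z : R[i]) (E : set R[i]) : \bar R :=
  ereal_inf [set (normc (z - w))%:E | w in E].

(* The integrand is extended-real valued, equal to [+oo] on [E]. *)
Definition Carleson_set (R : realType) (E : set R[i]) : Prop :=
  [/\ compact E, E `<=` @circle R &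
      (circle_integral (fun z => lne (edistC z E)^-1) < +oo)%E].

(* Main.v *)
From HB Require Import structures.
Require Import Defs.
From mathcomp Require Import all_boot all_order all_algebra.
From mathcomp Require Import all_classical all_reals all_analysis.
From mathcomp Require Import measurable_realfun.
From mathcomp.real_closed Require Import complex.
From mathcomp Require Import ring lra zify.

(** The atoms sit at [tau_n = cis theta_n] with [theta_n = 1 / ln (n + 4)], and
    the masses [c_n = 32 ^ - m_n], with [m_n = 4 (n + 16)], decay exponentially,
    so that [1 / ln (1 + 1 / c_n)] is of order [1 / n].

    No splitting: with [s_n = theta_n - theta_(n+1)], a Carleson set containing
    [tau_n] contributes at least [s_n ln (1 / s_n)] to its defining integral on
    the arc between [tau_(n+1)] and [tau_n]. Both [s_n ln (1 / s_n)] and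
    [1 / ln (1 + 1 / c_n)] dominate a multiple of
    [1 - ln (n + 4) / ln (n + 5)], whose sum diverges, so no set [C] can make the
    first sum finite over [C] and the second one finite over its complement.

    Factor: for [w = 1 - z / tau_n], the rational function
    [g_n = (1 / m_n) * \sum_(m_n <= i < 2 m_n) w / (w + 2 ^ - i)]
    is bounded by [1], vanishes at [tau_n], is close to [1] away from [tau_n],
    and has Dirichlet integral of order [1 / m_n], concentrated near [tau_n].
    Take [f = S_mu * (1 - z) * (\prod_n g_n) ^ 2]. The derivative of [S_mu] is
    killed by the [g_n ^ 2], because [c_n] is much smaller than the scale
    [4 ^ - m_n] of the dip. The discs around the [tau_n] where [g_n] varies are
    disjoint, and there [|1 - z|] is at most [2 theta_n], so the Dirichlet
    integral of [f] is bounded by a multiple of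
    [1 + \sum_n theta_n ^ 2 / m_n], which converges. *)

Set Implicit Arguments.
Unset Strict Implicit.
Unset Printing Implicit Defensive.

Import Order.TTheory GRing.Theory Num.Theory.
Import numFieldNormedType.Exports.
Import ComplexField Normc.

Local Open Scope classical_set_scope.
Local Open Scope ring_scope.
Local Open Scope complex_scope.

(** * Complex modulus, limits and differentiability *)

Section ComplexModulus.
Variable R : realType.
Implicit Types (x y z w q : R[i]).

Lemma normc_ge0 x : 0 <= normc x.
Proof. by case: x => a b; rewrite sqrtr_ge0. Qed.

Lemma ler_normcD x y : normc (x + y) <= normc x + normc y.
Proof. exact: le_normcD. Qed.

Lemma normc_opp x : normc (- x) = normc x.
Proof. exact: normcN. Qed.

Lemma normc_subC x y : normc (x - y) = normc (y - x).
Proof. by rewrite -normc_opp opprB. Qed.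

Lemma ler_normcB x y : normc (x - y) <= normc x + normc y.
Proof. by rewrite -[normc y]normc_opp; exact: ler_normcD. Qed.

Lemma lerB_normc x y : normc x - normc y <= normc (x - y).
Proof. by rewrite lerBlDr -{1}[x](subrK y) ler_normcD. Qed.

Lemma ler_normc_dist z x y : normc (x - y) <= normc (x - z) + normc (z - y).
Proof. by rewrite -[x - y](subrKA z); exact: ler_normcD. Qed.

Lemma normc_eq0 x : (normc x == 0) = (x == 0).
Proof. by apply/eqP/eqP => [/eq0_normc|->]; rewrite ?normc0. Qed.

Lemma normc_gt0 x : (0 < normc x) = (x != 0).
Proof. by rewrite lt_def normc_ge0 andbT normc_eq0. Qed.

Lemma normc_sqr x : normc x ^+ 2 = complex.Re x ^+ 2 + complex.Im x ^+ 2.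
Proof. by case: x => a b /=; rewrite sqr_sqrtr// addr_ge0// sqr_ge0. Qed.

Lemma normcX x n : normc (x ^+ n) = normc x ^+ n.
Proof.
by elim: n => [|n IH]; rewrite ?expr0 ?normc1// !exprS normcM IH.
Qed.

Lemma normc_real (a : R) : normc a%:C = `|a|.
Proof. by rewrite /= expr0n /= addr0 sqrtr_sqr. Qed.

Lemma ler_normc_Re x : `|complex.Re x| <= normc x.
Proof.
rewrite -(ler_pXn2r (n := 2)) ?nnegrE ?normc_ge0//.
by rewrite normc_sqr real_normK ?num_real// lerDl sqr_ge0.
Qed.

Lemma ler_normc_Im x : `|complex.Im x| <= normc x.
Proof.
rewrite -(ler_pXn2r (n := 2)) ?nnegrE ?normc_ge0//.
by rewrite normc_sqr real_normK ?num_real// lerDr sqr_ge0.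
Qed.

Lemma ler_normc_ReIm x : normc x <= `|complex.Re x| + `|complex.Im x|.
Proof.
rewrite -(ler_pXn2r (n := 2)) ?nnegrE ?normc_ge0 ?addr_ge0//.
rewrite normc_sqr sqrrD !real_normK ?num_real//.
by rewrite -addrA lerD2l lerDr mulrn_wge0// mulr_ge0.
Qed.

Lemma ler_normc_sum (I : Type) (r : seq I) (P : pred I) (F : I -> R[i]) :
  normc (\sum_(i <- r | P i) F i) <= \sum_(i <- r | P i) normc (F i).
Proof.
elim/big_ind2 : _ => [|x1 x2 y1 y2 h1 h2|//]; first by rewrite normc0.
exact: le_trans (ler_normcD _ _) (lerD h1 h2).
Qed.

Lemma Re_sum (I : Type) (r : seq I) (P : pred I) (F : I -> R[i]) :
  complex.Re (\sum_(i <- r | P i) F i) = \sum_(i <- r | P i) complex.Re (F i).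
Proof. by apply: (big_morph _ _ (erefl _)) => -[a b] [c d]. Qed.

Lemma Im_sum (I : Type) (r : seq I) (P : pred I) (F : I -> R[i]) :
  complex.Im (\sum_(i <- r | P i) F i) = \sum_(i <- r | P i) complex.Im (F i).
Proof. by apply: (big_morph _ _ (erefl _)) => -[a b] [c d]. Qed.

Lemma normc_normr x : `|x| = (normc x)%:C.
Proof. by case: x => a b; rewrite normc_def. Qed.

End ComplexModulus.

(** * Limits of complex sequences *)

Section ComplexLimits.
Variable R : realType.
Implicit Types (x y : nat -> R[i]) (l : R[i]).

(** Convergence is phrased with the real-valued modulus, so that bounds on [normc] pass to the limit
    without a detour through filters on [R[i]]. *)
Definition clim x l := forall e : R, 0 < e ->
  exists N : nat, forall n, (N <= n)%N -> normc (x n - l) < e.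

Lemma clim_ReIm x l : (fun n => complex.Re (x n)) @ \oo --> complex.Re l ->
  (fun n => complex.Im (x n)) @ \oo --> complex.Im l -> clim x l.
Proof.
move=> /cvgrPdist_lt hr /cvgrPdist_lt hi e e0.
have e20 : 0 < e / 2 by rewrite divr_gt0.
have [N1 _ h1] := hr _ e20; have [N2 _ h2] := hi _ e20.
exists (maxn N1 N2) => n; rewrite geq_max => /andP[n1 n2].
apply: le_lt_trans (ler_normc_ReIm _) _.
rewrite [ltRHS]splitr; move: (h1 n n1) (h2 n n2); rewrite !(distrC (complex.Re l)) !(distrC (complex.Im l)) /=.
by case: (x n) l {hr hi h1 h2} => [a b] [c d] /= u v; rewrite ltrD.
Qed.

Lemma climD x y l m : clim x l -> clim y m -> clim (fun n => x n + y n) (l + m).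
Proof.
move=> hx hy e e0; have e20 : 0 < e / 2 by rewrite divr_gt0.
have [N1 h1] := hx _ e20; have [N2 h2] := hy _ e20.
exists (maxn N1 N2) => n; rewrite geq_max => /andP[n1 n2].
rewrite opprD addrACA; apply: le_lt_trans (ler_normcD _ _) _.
by rewrite [ltRHS]splitr ltrD// ?h1 ?h2.
Qed.

Lemma climMl a x l : clim x l -> clim (fun n => a * x n) (a * l).
Proof.
move=> hx e e0; have a0 : 0 < normc a + 1 by rewrite ltr_wpDl// normc_ge0.
have [N h] := hx (e / (normc a + 1)) (divr_gt0 e0 a0).
exists N => n /h; rewrite -mulrBr normcM ltr_pdivlMr// mulrC.
by apply: le_lt_trans; rewrite ler_wpM2r ?normc_ge0// lerDl.
Qed.

Lemma clim_cst l : clim (fun=> l) l.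
Proof. by move=> e e0; exists 0%N => n _; rewrite subrr normc0. Qed.

Lemma climN x l : clim x l -> clim (fun n => - x n) (- l).
Proof.
move=> /(climMl (-1)) h e /h[N hN]; exists N => n /hN.
by rewrite !mulN1r.
Qed.

Lemma climB x y l m : clim x l -> clim y m -> clim (fun n => x n - y n) (l - m).
Proof. by move=> hx /climN; exact: climD. Qed.

Lemma clim_normc_le x l (b : R) (N : nat) :
  clim x l -> (forall n, (N <= n)%N -> normc (x n) <= b) -> normc l <= b.
Proof.
move=> hx hb; apply/ler_addgt0Pr => e /hx[N' h].
have := h _ (leq_maxr N N'); have := hb _ (leq_maxl N N').
move: (x _) => u ub ul; rewrite -[l](subrK u) addrC.
by rewrite (le_trans (ler_normcD _ _))// lerD// normc_subC ltW.
Qed.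

Lemma clim_Re_le x l (b : R) :
  clim x l -> (forall n, complex.Re (x n) <= b) -> complex.Re l <= b.
Proof.
move=> hx hb; apply/ler_addgt0Pr => e /hx[N /(_ _ (leqnn _))].
move=> h; have := le_lt_trans (ler_normc_Re _) h; have := hb N.
case: (x N) {h} => [u1 u2]; case: l {hx} => [l1 l2] /=.
by rewrite distrC => h /ltr_normlW; lra.
Qed.

(** Up to its first term the sequence is the sequence of partial sums of its increments, and that
    series converges absolutely because the sums of moduli stay below [D]. *)
Lemma cvg_of_summable_increments (u : nat -> R) (d : nat -> R) (D : R) :
  (forall n, `|u n.+1 - u n| <= d n) ->
  (forall n, \sum_(0 <= i < n) d i <= D) -> cvgn u.
Proof.
move=> ud dD.
have su : u = (fun=> u 0%N) \+ series (fun n => u n.+1 - u n).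
  apply/funext => n /=.
  by rewrite /series /= telescope_sumr// addrC subrK.
rewrite su; apply: is_cvgD; first exact: is_cvg_cst.
apply: normed_cvg; apply: nondecreasing_is_cvgn.
  apply/nondecreasing_seqP => n.
  change (\sum_(0 <= k < n) `|u k.+1 - u k| <= \sum_(0 <= k < n.+1) `|u k.+1 - u k|).
  rewrite big_nat_recr//= lerDl.
  exact: normr_ge0.
exists D => _ [n _ <-]; rewrite /series /=; apply: le_trans (dD n).
by apply: ler_sum => i _; exact: ud.
Qed.

Lemma clim_of_summable_increments x (d : nat -> R) (D : R) :
  (forall n, normc (x n.+1 - x n) <= d n) ->
  (forall n, \sum_(0 <= i < n) d i <= D) -> exists l, clim x l.
Proof.
move=> xd dD.
have cr : cvgn (fun n => complex.Re (x n)).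
  apply: (cvg_of_summable_increments _ dD) => n; apply: le_trans (xd n).
  by apply: le_trans (ler_normc_Re _); case: (x n.+1) (x n) => [? ?] [? ?].
have ci : cvgn (fun n => complex.Im (x n)).
  apply: (cvg_of_summable_increments _ dD) => n; apply: le_trans (xd n).
  by apply: le_trans (ler_normc_Im _); case: (x n.+1) (x n) => [? ?] [? ?].
exists (limn (fun n => complex.Re (x n)) +i* limn (fun n => complex.Im (x n))).
exact: clim_ReIm.
Qed.

End ComplexLimits.

(** * Differentiability with a quadratic remainder *)

Section QuadraticExpansions.
Variable R : realType.
Implicit Types (f g : R[i] -> R[i]) (z q : R[i]).

(* Differentiability at [z] with a quadratic error bound: unlike [derivable], it
   passes to pointwise limits when the bounds are uniform. *)
Definition expands f z q := exists B d : R, [/\ 0 <= B, 0 < d &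
  forall u, normc u < d -> normc (f (z + u) - f z - u * q) <= B * normc u ^+ 2].

Lemma expands_cvg f z q : expands f z q ->
  h^-1 *: ((f \o shift z) (h *: (1 : R[i])) - f z) @[h --> (0 : R[i])^'] --> q.
Proof.
move=> [B [d [B0 d0 hB]]]; apply/cvgrPdist_lt => e.
(* A positive element of [R[i]] has zero imaginary part, so the tolerance is really the positive
   number [complex.Re e]. *)
rewrite ltcE /= => /andP[/eqP ie re].
have e1 : 0 < complex.Re e / (B + 1) by rewrite divr_gt0// ltr_wpDl.
have m0 : 0 < Num.min d (complex.Re e / (B + 1)) by rewrite lt_min d0.
near=> h.
have h0 : h != 0 by near: h; exact: nbhs_dnbhs_neq.
have : `|h| < (Num.min d (complex.Re e / (B + 1)))%:C.
  near: h; apply: dnbhs0_lt; by rewrite ltcR.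
rewrite normc_normr ltcR lt_min => /andP[hd he].
rewrite distrC normc_normr ltcE /= -ie eqxx /=.
have hn : 0 < normc h by rewrite normc_gt0.
have -> : h^-1 *: (f (h *: 1 + z) - f z) - q = h^-1 * (f (z + h) - f z - h * q).
  rewrite [h *: 1](mulr1 h) mulrBr mulKf// [_ *: _]/GRing.scale /=.
  by rewrite [z + h]addrC.
rewrite normcM normcV ltr_pdivrMl//.
apply: le_lt_trans (hB _ hd) _.
rewrite expr2 mulrCA ltr_pM2l//.
apply: le_lt_trans (_ : (B + 1) * normc h < _); first by rewrite ler_wpM2r ?lerDl ?ltW.
by rewrite mulrC -ltr_pdivlMr// ltr_wpDl.
Unshelve. all: by end_near. Qed.

Lemma expands_derivable f z q : expands f z q -> derivable f z 1.
Proof. by move=> /expands_cvg h; apply/cvg_ex; exists q. Qed.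

Lemma expands_derive1 f z q : expands f z q -> derive1 f z = q.
Proof.
move=> /expands_cvg h; rewrite derive1E; exact: cvg_lim.
Qed.

Lemma ler_normc_expr1 (u : R[i]) : normc u <= 1 -> normc u ^+ 2 <= normc u.
Proof. by move=> u1; rewrite expr2 ler_piMl ?normc_ge0. Qed.

Lemma expands_lipschitz f z q : expands f z q -> exists A d : R, [/\ 0 <= A, 0 < d &
  forall u, normc u < d -> normc (f (z + u) - f z) <= A * normc u].
Proof.
(* The radius is kept below 1 so that the quadratic remainder is dominated by a linear one. *)
move=> [B [d [B0 d0 hB]]]; exists (B + normc q), (Num.min d 1).
split; rewrite ?addr_ge0 ?normc_ge0 ?lt_min ?d0 ?ltr01//.
move=> u; rewrite lt_min => /andP[ud u1].
rewrite -[f (z + u) - f z](subrK (u * q)) mulrDl.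
apply: le_trans (ler_normcD _ _) _; rewrite normcM [normc q * _]mulrC lerD2r.
by apply: le_trans (hB _ ud) _; rewrite ler_wpM2l// ler_normc_expr1// ltW.
Qed.

Lemma expandsM f g z p q : expands f z p -> expands g z q ->
  expands (fun x => f x * g x) z (p * g z + f z * q).
Proof.
move=> ef eg.
have [Af [df [Af0 df0 hAf]]] := expands_lipschitz ef.
have [Ag [dg [Ag0 dg0 hAg]]] := expands_lipschitz eg.
case: ef => Bf [ef [Bf0 ef0 hBf]]; case: eg => Bg [eg [Bg0 eg0 hBg]].
exists (Bf * normc (g z) + normc (f z) * Bg + Af * Ag),
  (Num.min (Num.min df dg) (Num.min ef eg)).
split; rewrite ?addr_ge0 ?mulr_ge0 ?normc_ge0 ?lt_min ?df0 ?dg0 ?ef0//.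
move=> u; rewrite !lt_min => /andP[/andP[u1 u2] /andP[u3 u4]].
(* The remainder of the product is made of the two remainders and of the product of the two
   increments, which is quadratic by the Lipschitz bounds. *)
rewrite (_ : _ - _ = (f (z + u) - f z - u * p) * g z +
   f z * (g (z + u) - g z - u * q) + (f (z + u) - f z) * (g (z + u) - g z)); last by ring.
apply: le_trans (ler_normcD _ _) _; rewrite [leRHS]mulrDl; apply: lerD.
  apply: le_trans (ler_normcD _ _) _; rewrite [leRHS]mulrDl !normcM; apply: lerD.
    by rewrite [leRHS]mulrAC ler_wpM2r ?normc_ge0// hBf.
  by rewrite -[leRHS]mulrA ler_wpM2l ?normc_ge0// hBg.
rewrite normcM expr2 mulrACA; apply: ler_pM; rewrite ?normc_ge0//; [exact: hAf|exact: hAg].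
Qed.

Lemma expands_linear (a b : R[i]) z : expands (fun x => a + b * x) z b.
Proof.
exists 0, 1; split => // u _.
by rewrite (_ : _ - _ = 0) ?normc0 ?mul0r//; ring.
Qed.

(** For fixed [u] the quadratic bound is a closed condition on the two values and on the derivative,
    and [B] and [d] are the same for all [n]. *)
Lemma clim_expands (F : nat -> R[i] -> R[i]) (Q : nat -> R[i]) f z q (B d : R) :
  0 <= B -> 0 < d ->
  (forall u, normc u < d -> clim (F ^~ (z + u)) (f (z + u))) -> clim Q q ->
  (forall n u, normc u < d -> normc (F n (z + u) - F n z - u * Q n) <= B * normc u ^+ 2) ->
  expands f z q.
Proof.
move=> B0 d0 hF hQ h; exists B, d; split=> // u ud.
have hz : clim (F ^~ z) (f z) by have := hF 0; rewrite normc0 addr0; exact.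
apply: (@clim_normc_le _ (fun n => F n (z + u) - F n z - u * Q n) _ _ 0).
  by apply: climB; [apply: climB => //; exact: hF|exact: climMl].
by move=> n _; exact: h.
Qed.

End QuadraticExpansions.

(** * The complex exponential and chords of the circle *)

Section ComplexExponential.
Variable R : realType.
Implicit Types (x y : R) (z w u q : R[i]).

Lemma norm_sin_le x : `|sin x| <= `|x|.
Proof.
have H (y : R) : 0 <= y -> `|sin y| <= y.
  rewrite le_eqVlt => /predU1P[<-|y0]; first by rewrite sin0 normr0.
  have [c _] := @MVT_segment R sin cos 0 y (ltW y0) (fun x _ => is_derive_sin x)
     (continuous_subspaceT (@continuous_sin R)).
  rewrite sin0 !subr0 => ->; rewrite normrM (gtr0_norm y0).
  by rewrite ler_piMl ?(ltW y0)// ler_norml cos_geN1 cos_le1.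
have [x0|/ltW x0] := leP 0 x; first by rewrite (ger0_norm x0) H.
by rewrite -normrN -sinN (le_trans (H _ _)) ?oppr_ge0// ler0_norm.
Qed.

Lemma one_minus_cos_ge0 x : 0 <= 1 - cos x.
Proof. by rewrite subr_ge0 cos_le1. Qed.

Lemma cos_double_sin x : 1 - cos x = 2 * sin (x / 2) ^+ 2.
Proof.
rewrite {1}(_ : x = x / 2 + x / 2); last by field.
rewrite cosD -!expr2; have := cos2Dsin2 (x / 2); lra.
Qed.

Lemma one_minus_cos_le x : 1 - cos x <= x ^+ 2 / 2.
Proof.
rewrite cos_double_sin.
have : sin (x / 2) ^+ 2 <= (x / 2) ^+ 2.
  by rewrite -real_normK ?num_real// -[leRHS]real_normK ?num_real// lerXn2r ?nnegrE// norm_sin_le.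
nra.
Qed.

Lemma norm_sin_sub_le x : `|sin x - x| <= `|x| ^+ 3 / 2.
Proof.
have H (y : R) : 0 <= y -> `|sin y - y| <= y ^+ 3 / 2.
  rewrite le_eqVlt => /predU1P[<-|y0]; first by rewrite sin0 subr0 normr0 expr0n mul0r.
  have [c] := @MVT_segment R sin cos 0 y (ltW y0) (fun x _ => is_derive_sin x)
     (continuous_subspaceT (@continuous_sin R)).
  rewrite in_itv /= => /andP[c0 cy]; rewrite sin0 !subr0 => ->.
  rewrite -[X in _ - X]mul1r -mulrBl normrM (gtr0_norm y0) distrC.
  rewrite ger0_norm ?one_minus_cos_ge0//.
  have -> : y ^+ 3 / 2 = y ^+ 2 / 2 * y by ring.
  rewrite ler_wpM2r ?(ltW y0)//; apply: le_trans (one_minus_cos_le _) _.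
  by rewrite ler_wpM2r// lerXn2r ?nnegrE// (le_trans c0 cy).
have [x0|/ltW x0] := leP 0 x; first by rewrite (ger0_norm x0) H.
rewrite -normrN (_ : - (sin x - x) = sin (- x) - (- x)); last by rewrite sinN; ring.
by rewrite (le_trans (H _ _)) ?oppr_ge0// ler0_norm.
Qed.

(** The upper estimate comes from [expR x * (1 - x) <= 1], itself a consequence of
    [1 - x <= expR (- x)]. *)
Lemma expR_quadratic x : `|x| <= 2^-1 -> `|expR x - 1 - x| <= 2 * x ^+ 2.
Proof.
move=> xh; have h1 := expR_ge1Dx x; have h2 := expR_ge1Dx (- x).
rewrite ger0_norm; last by lra.
move: xh; rewrite ler_norml => /andP[xl xu].
have e0 := expR_gt0 x.
have : expR x * (1 - x) <= 1.
  by rewrite -[leRHS](expRxMexpNx_1 x) ler_pM2l.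
have : 0 <= x ^+ 2 by exact: sqr_ge0.
rewrite expr2; nra.
Qed.

Lemma cexpD z w : cexp (z + w) = cexp z * cexp w.
Proof.
case: z w => [a b] [c d]; rewrite /cexp /cis /= expRD cosD sinD.
apply/eqP; rewrite eq_complex /=; apply/andP; split; apply/eqP; ring.
Qed.

Lemma normc_cis x : normc (cis x) = 1.
Proof. by rewrite /= cos2Dsin2 sqrtr1. Qed.

Lemma normc_cexp z : normc (cexp z) = expR (complex.Re z).
Proof. by rewrite /cexp normcM normc_real normc_cis mulr1 ger0_norm ?expR_ge0. Qed.

Lemma cexp_quadratic u : normc u <= 2^-1 -> normc (cexp u - 1 - u) <= 8 * normc u ^+ 2.
Proof.
move=> hu; have /le_trans/(_ hu) hx := ler_normc_Re u.
have /le_trans/(_ hu) hy := ler_normc_Im u.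
apply: le_trans (ler_normc_ReIm _) _; rewrite normc_sqr {hu}.
case: u hx hy => x y /= hx hy.
have hex := expR_quadratic hx.
have hc := one_minus_cos_le y; have hc0 := one_minus_cos_ge0 y.
have hs := norm_sin_sub_le y; have hs1 := norm_sin_le y.
have xx : x ^+ 2 = `|x| ^+ 2 by rewrite real_normK ?num_real.
have yy : y ^+ 2 = `|y| ^+ 2 by rewrite real_normK ?num_real.
have x0 := normr_ge0 x; have y0 := normr_ge0 y.
have e2 : expR x <= 2.
  have := ler_norm (expR x - 1 - x); have := ler_norm x; nra.
have hre : `|expR x * cos y - 1 - x| <= 2 * x ^+ 2 + y ^+ 2.
  rewrite (_ : _ - x = (expR x - 1 - x) - expR x * (1 - cos y)); last by ring.
  apply: le_trans (ler_normB _ _) _; apply: lerD => //.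
  rewrite normrM (ger0_norm (expR_ge0 x)) (ger0_norm hc0).
  have := expR_ge0 x; nra.
have him : `|expR x * sin y - y| <= 2 * `|x| * `|y| + `|y| ^+ 3 / 2.
  rewrite (_ : _ - y = (expR x - 1) * sin y + (sin y - y)); last by ring.
  apply: le_trans (ler_normD _ _) _; apply: lerD => //.
  rewrite normrM; apply: ler_pM => //.
  rewrite (_ : _ - 1 = (expR x - 1 - x) + x); last by ring.
  apply: le_trans (ler_normD _ _) _; nra.
have -> : expR x * cos y - 0 * sin y - 1 - x = expR x * cos y - 1 - x by ring.
have -> : expR x * sin y + 0 * cos y - 0 - y = expR x * sin y - y by ring.
have h3 : `|y| ^+ 3 <= `|y| ^+ 2 / 2 by rewrite exprS mulrC; have := sqr_ge0 `|y|; nra.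
have := sqr_ge0 (`|x| - `|y|); rewrite sqrrB; nra.
Qed.

Lemma expands_cexp_comp (f : R[i] -> R[i]) z q : expands f z q ->
  expands (fun w => cexp (f w)) z (cexp (f z) * q).
Proof.
move=> ef; have [A [d1 [A0 d10 hA]]] := expands_lipschitz ef.
case: ef => B [d2 [B0 d20 hB]].
(* The last radius keeps the increment [v] of [f] below 1/2 in modulus, the range of
   [cexp_quadratic]. *)
exists (normc (cexp (f z)) * (8 * A ^+ 2 + B)),
  (Num.min (Num.min d1 d2) (2^-1 / (A + 1))).
have A1 : 0 < A + 1 by rewrite ltr_wpDl.
split; rewrite ?mulr_ge0 ?addr_ge0 ?normc_ge0 ?mulr_ge0 ?exprn_ge0//.
  by rewrite !lt_min d10 d20 divr_gt0// invr_gt0.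
move=> u; rewrite !lt_min => /andP[/andP[u1 u2] u3].
have {}hA := hA _ u1; have {}hB := hB _ u2.
set v := f (z + u) - f z in hA.
have v2 : normc v <= 2^-1.
  apply: le_trans hA _; move: u3; rewrite ltr_pdivlMr// => u3.
  by have := normc_ge0 u; nra.
have hE := cexp_quadratic v2.
have -> : f (z + u) = f z + v by rewrite /v addrCA subrr addr0.
rewrite cexpD (_ : _ - _ = cexp (f z) * ((cexp v - 1 - v) + (v - u * q))); last by ring.
rewrite normcM -mulrA ler_wpM2l ?normc_ge0//.
apply: le_trans (ler_normcD _ _) _; rewrite mulrDl; apply: lerD => //.
apply: le_trans hE _; rewrite -mulrA ler_wpM2l// -exprMn.
by rewrite lerXn2r ?nnegrE ?normc_ge0 ?mulr_ge0 ?normc_ge0.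
Qed.

(** Chord length: after squaring, this is the half-angle formula for 1 - cos (x - y). *)
Lemma normc_cisB x y : normc (cis x - cis y) = 2 * `|sin ((x - y) / 2)|.
Proof.
apply: (@pexpIrn _ 2) => //; rewrite ?nnegrE ?normc_ge0 ?mulr_ge0//.
rewrite normc_sqr exprMn real_normK ?num_real//.
have := cos_double_sin (x - y); rewrite cosB /= => h.
have := cos2Dsin2 x; have := cos2Dsin2 y; nra.
Qed.

Lemma normc_cisB_le x y : normc (cis x - cis y) <= `|x - y|.
Proof.
rewrite normc_cisB; have := norm_sin_le ((x - y) / 2).
by rewrite normrM (@ger0_norm _ 2^-1)//; lra.
Qed.

(** Half the angle, [t], is at most 1/2 in absolute value, so the cubic error |sin t - t| is at most
    |t| / 8. *)
Lemma normc_cisB_ge x y : `|x - y| <= 1 -> `|x - y| / 2 <= normc (cis x - cis y).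
Proof.
rewrite normc_cisB => h; set t := (x - y) / 2.
have tE : `|x - y| = 2 * `|t| by rewrite /t normrM (@ger0_norm _ 2^-1)//; field.
rewrite tE in h *.
have h1 := norm_sin_sub_le t.
have h2 : `|t| <= `|sin t| + `|sin t - t|.
  by rewrite -lerBlDl distrC (le_trans (lerB_dist _ _))// .
have := normr_ge0 t; have : `|t| ^+ 3 <= `|t| / 4 by rewrite exprS; have := normr_ge0 t; nra.
nra.
Qed.

End ComplexExponential.

(** * The dip factors *)

Section DipFactors.
Variable R : realType.
Implicit Types (z w a b s u : R[i]) (h e : R).

Lemma Re_gt0_neq0 w : 0 < complex.Re w -> w != 0.
Proof. by apply: contraTneq => ->; rewrite ltxx. Qed.

(** Moving to the right inside the right half-plane increases the modulus; this keeps the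
    denominators of the dips at least as large as the gap. *)
Lemma ler_normc_addr w h : 0 < complex.Re w -> 0 <= h ->
  normc w <= normc (w + h%:C).
Proof.
move=> w0 h0; rewrite -(ler_pXn2r (n := 2)) ?nnegrE ?normc_ge0// !normc_sqr.
by case: w w0 => x y /= x0; nra.
Qed.

Lemma ler_normc_addl w h : 0 < complex.Re w -> 0 <= h -> h <= normc (w + h%:C).
Proof.
move=> w0 h0; apply: le_trans (ler_normc_Re _); apply: le_trans (ler_norm _).
by case: w w0 => x y /= x0; lra.
Qed.

Lemma normc_inv_le a e : 0 < e -> e <= normc a -> normc a^-1 <= e^-1.
Proof.
move=> e0 ea; rewrite normcV lef_pV2 ?posrE//; exact: lt_le_trans ea.
Qed.

Lemma normc_invB a b e : 0 < e -> e <= normc a -> e <= normc b ->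
  normc (b^-1 - a^-1) <= normc (b - a) / e ^+ 2.
Proof.
move=> e0 ea eb.
have a0 : a != 0 by rewrite -normc_gt0; exact: lt_le_trans ea.
have b0 : b != 0 by rewrite -normc_gt0; exact: lt_le_trans eb.
have -> : b^-1 - a^-1 = (a - b) * (a^-1 * b^-1) by field; rewrite a0 b0.
rewrite !normcM normc_subC ler_wpM2l ?normc_ge0// expr2 invfM.
by apply: ler_pM; rewrite ?normc_ge0// normc_inv_le.
Qed.

(** The Taylor remainder of the inverse is exactly (b - a)^2 / (a^2 b). *)
Lemma normc_inv_quadratic a b e : 0 < e -> e <= normc a -> e <= normc b ->
  normc (b^-1 - a^-1 + (b - a) / a ^+ 2) <= normc (b - a) ^+ 2 / e ^+ 3.
Proof.
move=> e0 ea eb.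
have a0 : a != 0 by rewrite -normc_gt0; exact: lt_le_trans ea.
have b0 : b != 0 by rewrite -normc_gt0; exact: lt_le_trans eb.
have -> : b^-1 - a^-1 + (b - a) / a ^+ 2 = (b - a) ^+ 2 * (a^-1 * a^-1 * b^-1).
  by field; rewrite a0 b0.
rewrite normcM normcX ler_wpM2l ?exprn_ge0 ?normc_ge0//.
have -> : (e ^+ 3)^-1 = e^-1 * e^-1 * e^-1 by field; rewrite gt_eqF.
have hl c : e <= normc c -> 0 <= normc c^-1 <= e^-1.
  by move=> ec; rewrite normc_ge0 normc_inv_le.
have /andP[? ?] := hl _ ea; have /andP[? ?] := hl _ eb.
by rewrite !normcM; apply: ler_pM => //; rewrite ?mulr_ge0 ?normc_ge0//; apply: ler_pM.
Qed.

(* For [s = tau^-1] on the circle, [gap s z = 1 - z / tau] has the modulus of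
   [z - tau] and a positive real part on the disc. *)
Definition gap s z := 1 - s * z.

Lemma gapD s z u : gap s (z + u) = gap s z - s * u.
Proof. by rewrite /gap; ring. Qed.

Lemma gap_ge s z : normc s = 1 -> 1 - normc z <= normc (gap s z).
Proof.
by move=> s1; apply: le_trans (lerB_normc _ _); rewrite normcM s1 mul1r normc1.
Qed.

Lemma Re_gap_gt0 s z : normc s = 1 -> disc z -> 0 < complex.Re (gap s z).
Proof.
rewrite /disc /= => s1 z1.
have -> : complex.Re (gap s z) = 1 - complex.Re (s * z).
  by rewrite /gap; case: (s * z) => x y.
rewrite subr_gt0; apply: le_lt_trans (ler_norm _) _.
by apply: le_lt_trans (ler_normc_Re _) _; rewrite normcM s1 mul1r.
Qed.

Lemma normc_gap s z : normc s = 1 -> normc (gap s z) = normc (z - s^-1).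
Proof.
move=> s1; have s0 : s != 0 by rewrite -normc_gt0 s1.
rewrite /gap (_ : 1 - s * z = s * (s^-1 - z)); last by rewrite mulrBr mulfV.
by rewrite normcM s1 mul1r normc_subC.
Qed.

Definition avg (m : nat) (F : nat -> R[i]) : R[i] :=
  (m%:R^-1)%:C * \sum_(m <= i < 2 * m) F i.

Lemma eq_avg m F G : F =1 G -> avg m F = avg m G.
Proof. by move=> FG; rewrite /avg; under eq_bigr do rewrite FG. Qed.

Lemma avgB m F G : avg m F - avg m G = avg m (fun i => F i - G i).
Proof. by rewrite /avg sumrB mulrBr. Qed.

Lemma avgMl m a F : a * avg m F = avg m (fun i => a * F i).
Proof. by rewrite /avg mulrCA mulr_sumr. Qed.

Lemma normc_avg_sum m F :
  normc (avg m F) <= m%:R^-1 * \sum_(m <= i < 2 * m) normc (F i).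
Proof.
rewrite /avg normcM normc_real ger0_norm ?invr_ge0//.
by rewrite ler_wpM2l ?invr_ge0// ler_normc_sum.
Qed.

Lemma normc_avg_le m F h : (0 < m)%N ->
  (forall i, (m <= i < 2 * m)%N -> normc (F i) <= h) -> normc (avg m F) <= h.
Proof.
move=> m0 hF; apply: le_trans (normc_avg_sum _ _) _.
rewrite ler_pdivrMl ?ltr0n//.
apply: (@le_trans _ _ (\sum_(m <= i < 2 * m) h)).
  by rewrite !big_nat; apply: ler_sum => i /hF.
by rewrite sumr_const_nat (_ : (2 * m - m = m)%N) ?mulr_natl//; lia.
Qed.

Lemma avg1 m : (0 < m)%N -> avg m (fun=> 1) = 1.
Proof.
move=> m0; rewrite /avg sumr_const_nat (_ : (2 * m - m = m)%N); last by lia.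
have -> : (1 : R[i]) *+ m = (m%:R : R)%:C by rewrite rmorph_nat.
by rewrite -rmorphM mulVf ?pnatr_eq0 -?lt0n// .
Qed.

(* [1 - dip] is an average over dyadic scales [h] of [h / (w + h)]: a rational
   substitute for a logarithm, whose Dirichlet integral is of order [1 / m]. *)
Definition dip m s z := avg m (fun i => gap s z / (gap s z + (2 ^- i)%:C)).

(** The termwise derivative of [dip]: w / (w + h) has derivative h w' / (w + h)^2, and w' = - s. *)
Definition ddip m s z :=
  avg m (fun i => - s * (2 ^- i)%:C / (gap s z + (2 ^- i)%:C) ^+ 2).

Section Estimates.
Variables (m : nat) (s : R[i]).
Hypotheses (m0 : (0 < m)%N) (s1 : normc s = 1).

Lemma pow2_ge0 i : 0 <= 2 ^- i :> R.
Proof. by rewrite invr_ge0 exprn_ge0. Qed.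

Lemma normc_pow2 i : normc (2 ^- i : R)%:C = 2 ^- i.
Proof. by rewrite normc_real ger0_norm ?pow2_ge0. Qed.

Lemma pow2_le i j : (i <= j)%N -> 2 ^- j <= 2 ^- i :> R.
Proof. by move=> ij; rewrite lef_pV2 ?posrE ?exprn_gt0// ler_eXn2l// ltr1n. Qed.

Lemma gap_pow2_neq0 z i : disc z -> gap s z + (2 ^- i)%:C != 0.
Proof.
move=> /(Re_gap_gt0 s1) h; rewrite -normc_gt0.
by apply: lt_le_trans (ler_normc_addr h (pow2_ge0 i)); rewrite normc_gt0 Re_gt0_neq0.
Qed.

Lemma one_sub_dipE z : disc z ->
  1 - dip m s z = avg m (fun i => (2 ^- i)%:C / (gap s z + (2 ^- i)%:C)).
Proof.
move=> z1; rewrite -(avg1 m0) avgB; apply: eq_avg => i.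
have d0 := gap_pow2_neq0 i z1.
by rewrite -{1}(mulfV d0) -mulrBl addrAC subrr add0r.
Qed.

Lemma dip_le1 z : disc z -> normc (dip m s z) <= 1.
Proof.
move=> /(Re_gap_gt0 s1) h; apply: normc_avg_le => // i _.
have h2 := ler_normc_addr h (pow2_ge0 i).
have : 0 < normc (gap s z) by rewrite normc_gt0 Re_gt0_neq0.
by move=> h3; rewrite normcM normcV ler_pdivrMr ?mul1r// (lt_le_trans h3).
Qed.

(** Each term is at most the gap divided by its scale, and all scales are at least 4 ^- m. *)
Lemma dip_le z : disc z -> normc (dip m s z) <= 4 ^+ m * normc (gap s z).
Proof.
move=> /(Re_gap_gt0 s1) h; apply: normc_avg_le => // i /andP[_ i2].
rewrite normcM mulrC ler_wpM2r ?normc_ge0//.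
apply: le_trans (_ : (2 ^- i)^-1 <= _).
  by apply: normc_inv_le; rewrite ?invr_gt0 ?exprn_gt0// ler_normc_addl// pow2_ge0.
rewrite invrK -[4](_ : 2 ^+ 2 = _) -?exprM; last by rewrite -natrX.
by rewrite ler_eXn2l ?ltr1n// ltnW.
Qed.

(** Each term h / (w + h) of the average is at most h / |w| in modulus, and the largest scale h is 2
    ^- m. *)
Lemma one_sub_dip_le z : disc z -> normc (1 - dip m s z) <= 2 ^- m / normc (gap s z).
Proof.
move=> z1; have h := Re_gap_gt0 s1 z1; rewrite one_sub_dipE//.
apply: normc_avg_le => // i /andP[mi _].
rewrite normcM normc_pow2; apply: ler_pM; rewrite ?pow2_ge0 ?normc_ge0 ?pow2_le//.
by apply: normc_inv_le; rewrite ?ler_normc_addr ?pow2_ge0// normc_gt0 Re_gt0_neq0.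
Qed.

Lemma ddip_le z : disc z -> normc (ddip m s z) <= 2 ^- m / normc (gap s z) ^+ 2.
Proof.
move=> z1; have h := Re_gap_gt0 s1 z1.
apply: normc_avg_le => // i /andP[mi _].
rewrite normcM normcM normc_opp s1 mul1r normc_pow2.
apply: ler_pM; rewrite ?pow2_ge0 ?normc_ge0 ?pow2_le//.
have g0 : 0 < normc (gap s z) by rewrite normc_gt0 Re_gt0_neq0.
apply: normc_inv_le; first by rewrite exprn_gt0.
by rewrite normcX lerXn2r ?nnegrE ?normc_ge0// ler_normc_addr// pow2_ge0.
Qed.

Lemma ler_gap_pow2 z e i : 0 < e -> normc z <= 1 - e -> e <= normc (gap s z + (2 ^- i)%:C).
Proof.
move=> e0 ze; have z1 : disc z by rewrite /disc /=; lra.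
apply: le_trans (ler_normc_addr (Re_gap_gt0 s1 z1) (pow2_ge0 i)).
by apply: le_trans (gap_ge _ s1); lra.
Qed.

(** The factor 2 ^- m is kept here and in the quadratic bound below: being summable over the nodes,
    it makes the estimates on partial products uniform. *)
Lemma dipB_le z u e : 0 < e -> normc z <= 1 - e -> normc (z + u) <= 1 - e ->
  normc (dip m s (z + u) - dip m s z) <= 2 ^- m / e ^+ 2 * normc u.
Proof.
move=> e0 ze zue.
have z1 : disc z by rewrite /disc /=; lra.
have zu1 : disc (z + u) by rewrite /disc /=; lra.
rewrite (_ : _ - _ = (1 - dip m s z) - (1 - dip m s (z + u))); last by ring.
rewrite !one_sub_dipE// avgB; apply: normc_avg_le => // i /andP[mi _].
rewrite -mulrBr normcM normc_pow2 -mulrA.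
apply: ler_pM; rewrite ?pow2_ge0 ?normc_ge0 ?pow2_le//.
have := normc_invB e0 (ler_gap_pow2 i e0 zue) (ler_gap_pow2 i e0 ze).
rewrite -[X in _ <= X / _]normc_opp gapD (_ : - (_ - _) = - (s * u)); last by ring.
by rewrite normc_opp normcM s1 mul1r [normc u / _]mulrC.
Qed.

Lemma dip_quadratic z u e : 0 < e -> normc z <= 1 - e -> normc (z + u) <= 1 - e ->
  normc (dip m s (z + u) - dip m s z - u * ddip m s z) <= 2 ^- m / e ^+ 3 * normc u ^+ 2.
Proof.
move=> e0 ze zue.
have z1 : disc z by rewrite /disc /=; lra.
have zu1 : disc (z + u) by rewrite /disc /=; lra.
rewrite (_ : _ - _ - _ = (1 - dip m s z) - (1 - dip m s (z + u)) - u * ddip m s z); last by ring.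
rewrite !one_sub_dipE// /ddip avgMl !avgB; apply: normc_avg_le => // i /andP[mi _].
have := normc_inv_quadratic e0 (ler_gap_pow2 i e0 ze) (ler_gap_pow2 i e0 zue).
rewrite gapD; set h := (2 ^- i)%:C; rewrite [gap s z - _ + _]addrAC; set a := gap s z + h.
rewrite (_ : a - s * u - a = - (s * u)); last by ring.
rewrite normc_opp normcM s1 mul1r => hq.
rewrite (_ : _ - _ = - (h * ((a - s * u)^-1 - a^-1 + - (s * u) / a ^+ 2))); last by ring.
rewrite normc_opp normcM normc_pow2 -mulrA.
apply: ler_pM; rewrite ?pow2_ge0 ?normc_ge0 ?pow2_le//.
by rewrite [leRHS]mulrC.
Qed.

Lemma sum_pow2 n : \sum_(0 <= i < n) 2 ^+ i <= 2 ^+ n :> R.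
Proof.
elim: n => [|n IH]; first by rewrite big_geq.
by rewrite big_nat_recr//= exprS mulr2n mulrDl !mul1r lerD.
Qed.

Lemma sum_pow2V l k : \sum_(0 <= j < k) 2 ^- (l + j) <= 2 * 2 ^- l - 2 * 2 ^- (l + k) :> R.
Proof.
elim: k => [|k IH]; first by rewrite big_geq// addn0 subrr.
rewrite big_nat_recr//= addnS exprS invfM.
have := pow2_ge0 (l + k); lra.
Qed.

(** The bounds grow geometrically up to index [l] and decay geometrically afterwards, so the sum is
    comparable to its peak: the head contributes at most 2 * 2 ^ l and the tail at most 4 * 2 ^
    l. *)
Lemma sum_ddip_terms (F : nat -> R) l n : (forall i, 0 <= F i) ->
  (forall i, F i <= 2 ^+ i) -> (forall i, (l < i < n)%N -> F i <= 4 ^+ l.+1 * 2 ^- i) ->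
  \sum_(0 <= i < n) F i <= 6 * 2 ^+ l.
Proof.
move=> F0 F1 F2.
have [nl|ln] := leqP n l.+1.
  apply: (@le_trans _ _ (2 ^+ l.+1)).
    apply: le_trans (_ : \sum_(0 <= i < n) 2 ^+ i <= _); first exact: ler_sum.
    by apply: le_trans (sum_pow2 n) _; rewrite ler_eXn2l// ltr1n.
  by rewrite exprS ler_wpM2r ?exprn_ge0// ler_nat.
rewrite (big_cat_nat _ (n := l.+1))//=; last exact: ltnW.
have -> : 6 * 2 ^+ l = 2 ^+ l.+1 + 4 * 2 ^+ l :> R by rewrite exprS; ring.
apply: lerD.
  by apply: le_trans (sum_pow2 _); apply: ler_sum.
rewrite -{1}[l.+1]add0n big_addn big_nat.
apply: le_trans (_ : \sum_(0 <= j < n - l.+1) 4 ^+ l.+1 * 2 ^- (l.+1 + j) <= _).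
  rewrite [leRHS]big_nat; apply: ler_sum => j /andP[_ jn].
  by rewrite addnC F2//; lia.
rewrite -mulr_sumr; apply: le_trans (_ : 4 ^+ l.+1 * (2 * 2 ^- l.+1) <= _).
  rewrite ler_wpM2l ?exprn_ge0//; apply: le_trans (sum_pow2V _ _) _.
  by rewrite lerBlDr lerDl mulr_ge0// pow2_ge0.
rewrite le_eqVlt; apply/orP; left; apply/eqP.
rewrite -[4](_ : 2 ^+ 2 = _) -?exprM; last by rewrite -natrX.
rewrite mulnC exprM [2 ^+ l.+1]exprS; field.
by rewrite expf_neq0.
Qed.

(** Take for 2 ^- l the smallest dyadic scale above |w|, with [l] capped at 2m. A term of scale h is
    at most 1 / h and at most h / |w|^2, so the sum peaks near h = 2 ^- l, and averaging leaves a
    factor 1 / m. Each of the roughly 2m scales then contributes about 1 / m^2 to the Dirichlet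
    integral, which gives 1 / m in all. *)
Lemma ddip_near z : disc z -> normc (gap s z) < 1 ->
  exists l, [/\ (l <= 2 * m)%N, normc (gap s z) < 2 ^- l &
    normc (ddip m s z) <= 6 / m%:R * 2 ^+ l].
Proof.
move=> z1 w1; have h := Re_gap_gt0 s1 z1.
pose P l := (normc (gap s z) < 2 ^- l) && (l <= 2 * m)%N.
have exP : exists l, P l by exists 0%N; rewrite /P expr0 invr1 w1.
have ubP l : P l -> (l <= 2 * m)%N by case/andP.
case: (ex_maxnP exP ubP) => l /andP[wl l2m] lmax.
exists l; split => //; apply: le_trans (normc_avg_sum _ _) _.
rewrite [6 / _]mulrC -mulrA ler_wpM2l ?invr_ge0//.
pose F i : R := normc (- s * (2 ^- i)%:C / (gap s z + (2 ^- i)%:C) ^+ 2).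
have FE i : F i = 2 ^- i * (normc (gap s z + (2 ^- i)%:C) ^+ 2)^-1.
  by rewrite /F !normcM normc_opp s1 mul1r normc_pow2 normcV normcX.
apply: le_trans (_ : \sum_(0 <= i < 2 * m) F i <= _).
  rewrite [leRHS](big_cat_nat _ (n := m))//=; last by lia.
  by rewrite lerDr sumr_ge0// => i _; exact: normc_ge0.
have den i : 0 < normc (gap s z + (2 ^- i)%:C) ^+ 2.
  by rewrite exprn_gt0// normc_gt0 gap_pow2_neq0.
apply: sum_ddip_terms => i; first exact: normc_ge0.
  rewrite FE ler_pdivrMr// [leLHS](_ : _ = 2 ^+ i * (2 ^- i) ^+ 2).
    rewrite ler_wpM2l ?exprn_ge0// lerXn2r ?nnegrE ?normc_ge0 ?pow2_ge0//.
    by rewrite ler_normc_addl// pow2_ge0.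
  by rewrite expr2 mulrA mulfV ?mul1r// expf_neq0.
move=> /andP[li im].
(* Otherwise [l.+1] would contradict maximality; it respects the cap because [l < i < 2 * m]. *)
have wl1 : 2 ^- l.+1 <= normc (gap s z).
  rewrite leNgt; apply/negP => w2.
  have : P l.+1 by rewrite /P w2 /=; lia.
  by move=> /lmax; rewrite ltnn.
rewrite FE mulrC ler_wpM2r ?pow2_ge0//.
rewrite -[leRHS]invrK lef_pV2 ?posrE ?invr_gt0 ?exprn_gt0//; last by rewrite normc_gt0 gap_pow2_neq0.
rewrite -[4](_ : 2 ^+ 2 = _) -?exprM; last by rewrite -natrX.
rewrite mulnC exprM -exprVn lerXn2r ?nnegrE ?pow2_ge0 ?normc_ge0//.
by apply: le_trans wl1 _; rewrite ler_normc_addr// pow2_ge0.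
Qed.

End Estimates.
End DipFactors.

(** * Atoms and masses *)

Section Nodes.
Variable R : realType.

(** The shift by 4 gives [1 <= lg n], so that all angles [theta n] lie in ]0, 1]. *)
Definition lg (n : nat) : R := ln n.+4%:R.
Definition lgstep (n : nat) : R := lg n.+1 - lg n.
Definition theta (n : nat) : R := (lg n)^-1.
Definition width (n : nat) : R := theta n - theta n.+1.
(** [2 ^- level n] is the radius of the disc around the node where its dip is felt. The depth is
    four times the level, so outside that disc the derivative bound 2 ^- depth / |w|^2 is still
    below the radius. *)
Definition level (n : nat) : nat := (n + 16)%N.
Definition depth (n : nat) : nat := (4 * level n)%N.
(** 32 = 16 * 2: the power of 16 pays for the square of the bound in [dip_le], and the power of 2 is
    left over for summability. *)
Definition coef (n : nat) : R := 32 ^- depth n.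
Definition node (n : nat) : R[i] := cis (theta n).

Lemma depth_gt0 n : (0 < depth n)%N.
Proof. by rewrite /depth /level; lia. Qed.

Lemma ln_le_sub1 (x : R) : 0 < x -> ln x <= x - 1.
Proof. by move=> x0; rewrite -{1}(subrK 1 x) addrC le_ln1Dx//; lra. Qed.

Lemma ln_ge_1subV (x : R) : 0 < x -> 1 - x^-1 <= ln x.
Proof.
move=> x0; have := @ln_le_sub1 x^-1; rewrite invr_gt0 => /(_ x0).
rewrite lnV ?posrE//; lra.
Qed.

Lemma lg_ge1 n : 1 <= lg n.
Proof.
apply: (@le_trans _ _ (ln 4)); last first.
  by rewrite /lg ler_ln ?posrE ?ltr0n// ler_nat.
have : 2^-1 <= ln (2 : R) by apply: le_trans (ln_ge_1subV _); [lra|].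
have -> : 4 = 2 * 2 :> R by ring.
by rewrite lnM ?posrE//; lra.
Qed.

Lemma lg_gt0 n : 0 < lg n.
Proof. exact: lt_le_trans (lg_ge1 n). Qed.

Lemma lgstepE n : lgstep n = ln (n.+4.+1%:R / n.+4%:R).
Proof. by rewrite /lgstep /lg ln_div ?posrE// ltr0n. Qed.

Lemma lgstep_le n : lgstep n <= n.+4%:R^-1.
Proof.
rewrite lgstepE; apply: le_trans (ln_le_sub1 _) _; first by rewrite divr_gt0 ?ltr0n.
rewrite -(natr1 n.+4) le_eqVlt; apply/orP; left; apply/eqP.
by field; rewrite gt_eqF// ltr0n.
Qed.

Lemma lgstep_ge n : n.+4.+1%:R^-1 <= lgstep n.
Proof.
rewrite lgstepE; apply: le_trans (ln_ge_1subV _); last by rewrite divr_gt0 ?ltr0n.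
rewrite invf_div -(natr1 n.+4) le_eqVlt; apply/orP; left; apply/eqP.
have h : n.+4%:R + 1 != 0 :> R by rewrite natr1 pnatr_eq0.
by apply: (mulIf h); rewrite mulrBl mulVf// mulfVK// mul1r addrAC subrr add0r.
Qed.

Lemma lgstep_gt0 n : 0 < lgstep n.
Proof. by apply: lt_le_trans (lgstep_ge n); rewrite invr_gt0 ltr0n. Qed.

Lemma lgS n : lg n.+1 = lg n + lgstep n.
Proof. by rewrite /lgstep addrC subrK. Qed.

Lemma lgS_le n : lg n.+1 <= 2 * lg n.
Proof.
have h : lgstep n <= 1.
  by apply: le_trans (lgstep_le n) _; rewrite invf_le1 ?ltr0n// ler1n.
by rewrite lgS; have := lg_ge1 n; lra.
Qed.

Lemma lg_le n : lg n <= n.+4%:R.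
Proof.
by apply: le_trans (ln_le_sub1 _) _; rewrite ?ltr0n// lerBlDr lerDl.
Qed.

Lemma theta_gt0 n : 0 < theta n.
Proof. by rewrite invr_gt0 lg_gt0. Qed.

Lemma theta_le1 n : theta n <= 1.
Proof. by rewrite invf_le1 ?lg_gt0// lg_ge1. Qed.

Lemma widthE n : width n = lgstep n / (lg n * lg n.+1).
Proof.
rewrite /width /theta /lgstep; have := lg_gt0 n; have := lg_gt0 n.+1 => h1 h2.
by field; rewrite !gt_eqF.
Qed.

Lemma width_gt0 n : 0 < width n.
Proof. by rewrite widthE divr_gt0 ?mulr_gt0 ?lg_gt0 ?lgstep_gt0. Qed.

Lemma thetaS n : theta n.+1 = theta n - width n.
Proof. by rewrite /width opprB addrC subrK. Qed.

Lemma theta_decr i j : (i <= j)%N -> theta j <= theta i.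
Proof.
move=> ij; rewrite lef_pV2 ?posrE ?lg_gt0// /lg ler_ln ?posrE ?ltr0n// ler_nat.
lia.
Qed.

Lemma width_le n : width n <= n.+4%:R^-1.
Proof.
apply: le_trans (lgstep_le n); rewrite widthE ler_pdivrMr ?mulr_gt0 ?lg_gt0//.
rewrite ler_peMr ?(ltW (lgstep_gt0 n))//.
by rewrite -[1]mulr1 ler_pM// lg_ge1.
Qed.

(** Since [width n] is at most 1 / (n + 4), its logarithmic factor is at least [lg n], which cancels
    one of the two logarithms in the denominator of [width n]. *)
Lemma width_ln_ge n : lgstep n / lg n.+1 <= width n * ln (width n)^-1.
Proof.
apply: (@le_trans _ _ (width n * lg n)).
  rewrite widthE le_eqVlt; apply/orP; left; apply/eqP.
  by have := lg_gt0 n; have := lg_gt0 n.+1 => h1 h2; field; rewrite !gt_eqF.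
rewrite ler_pM2l ?width_gt0// /lg ler_ln ?posrE ?invr_gt0 ?width_gt0 ?ltr0n//.
rewrite -[leLHS]invrK lef_pV2 ?posrE ?width_gt0 ?invr_gt0 ?ltr0n//.
exact: width_le.
Qed.

Lemma coef_gt0 n : 0 < coef n.
Proof. by rewrite invr_gt0 exprn_gt0. Qed.

(** From 1 + 32^m <= 33^m and ln 33 <= 32 the logarithm is at most 32 m, and m = 4 (n + 16) <= 16 (n
    + 4); hence the constant 512 = 32 * 16. *)
Lemma coef_cost n : 512^-1 * (lgstep n / lg n.+1) <= (ln (1 + (coef n)^-1))^-1.
Proof.
rewrite /coef invrK; set m := depth n.
have m0 : (0 < m)%N by rewrite /m /depth /level; lia.
have h1 : 1 + 32 ^+ m <= 33 ^+ m :> R.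
  have -> : 33 = 32 + 1 :> R by ring.
  case: m m0 => // k _; elim: k => [|k IH]; first by rewrite !expr1 addrC.
  rewrite exprS [leRHS]exprS [leRHS]mulrDl mul1r.
  apply: le_trans (_ : 32 * (1 + 32 ^+ k.+1) + 1 <= _).
    by lra.
  rewrite lerD ?ler_wpM2l// exprn_ege1//; lra.
have h2 : ln (1 + 32 ^+ m : R) <= 32 * m%:R.
  apply: le_trans (_ : ln (33 ^+ m : R) <= _).
    by rewrite ler_ln ?posrE ?exprn_gt0 ?ltr_wpDr ?exprn_ge0.
  rewrite lnXn// -[ln 33 *+ m]mulr_natr ler_wpM2r//.
  by apply: le_trans (ln_le_sub1 _) _; lra.
have l0 : 0 < ln (1 + 32 ^+ m : R).
  by rewrite ln_gt0// ltrDl exprn_gt0.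
apply: le_trans (_ : (32 * m%:R)^-1 <= _); last first.
  by rewrite lef_pV2 ?posrE ?mulr_gt0 ?ltr0n.
apply: le_trans (_ : 512^-1 * n.+4%:R^-1 <= _).
  apply: ler_wpM2l; first by lra.
  rewrite ler_pdivrMr ?lg_gt0//; apply: le_trans (lgstep_le n) _.
  by rewrite ler_peMr ?invr_ge0 ?lg_ge1.
rewrite -invfM lef_pV2 ?posrE ?mulr_gt0 ?ltr0n// /m /depth /level.
rewrite -!natrM ler_nat; lia.
Qed.

(** An Abel-Dini argument: the increments of ln [lg] are at most the relative increments of [lg],
    and [lg i.+1 <= 2 * lg i] changes the denominator at the cost of the factor 2. *)
Lemma ln_lg_le_sum n : ln (lg n) - ln (lg 0) <= 2 * \sum_(0 <= i < n) lgstep i / lg i.+1.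
Proof.
rewrite mulr_sumr -(telescope_sumr (fun i => ln (lg i)) (leq0n n)); apply: ler_sum => i _.
rewrite -ln_div ?posrE ?lg_gt0//; apply: le_trans (ln_le_sub1 _) _.
  by rewrite divr_gt0 ?lg_gt0.
have -> : lg i.+1 / lg i - 1 = lgstep i / lg i.
  by rewrite lgS; field; rewrite gt_eqF ?lg_gt0.
rewrite mulrCA ler_pM2l ?lgstep_gt0// -[2]invrK -invfM.
by rewrite lef_pV2 ?posrE ?mulr_gt0 ?lg_gt0// ler_pdivrMl// lgS_le.
Qed.

Lemma lg_unbounded (B : R) : exists n, B < lg n.
Proof.
exists (Num.trunc (expR B)); rewrite -[ltLHS]expRK /lg ltr_ln ?posrE ?expR_gt0 ?ltr0n//.
by apply: lt_le_trans (truncnS_gt _) _; rewrite ler_nat ltnS -addn3 leq_addr.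
Qed.

Lemma sum_lgstep_unbounded (B : R) : exists n, B < \sum_(0 <= i < n) lgstep i / lg i.+1.
Proof.
have [n hn] := lg_unbounded (expR (2 * B + ln (lg 0))); exists n.
have : 2 * B + ln (lg 0) < ln (lg n).
  by rewrite -[ltLHS]expRK ltr_ln ?posrE ?expR_gt0 ?lg_gt0.
have := ln_lg_le_sum n; lra.
Qed.

Lemma theta_small (e : R) : 0 < e -> exists N, forall n, (N <= n)%N -> theta n < e.
Proof.
move=> e0; have [N hN] := lg_unbounded e^-1; exists N => n Nn.
apply: le_lt_trans (theta_decr Nn) _.
by rewrite /theta -[e]invrK ltf_pV2 ?posrE ?invr_gt0 ?lg_gt0.
Qed.

(** Both sides are of order 1 / (n ln^2 n); comparing with [width], a difference of consecutive
    angles, makes the sum telescope. *)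
Lemma theta_depth_term n : theta n ^+ 2 / (depth n)%:R <= width n.
Proof.
have a0 := lg_gt0 n; have a1 := lg_gt0 n.+1.
have h1 : (lg n)^-1 <= 2 * (lg n.+1)^-1.
  by rewrite -[2]invrK -invfM lef_pV2 ?posrE ?mulr_gt0// ler_pdivrMl// lgS_le.
have h2 : (depth n)%:R^-1 <= 2^-1 * lgstep n.
  apply: le_trans (_ : 2^-1 * n.+4.+1%:R^-1 <= _); last by rewrite ler_pM2l// lgstep_ge.
  rewrite -invfM lef_pV2 ?posrE ?mulr_gt0 ?ltr0n ?depth_gt0// -natrM ler_nat /depth /level; lia.
have -> : width n = (lg n)^-1 * (2 * (lg n.+1)^-1) * (2^-1 * lgstep n).
  by rewrite widthE; field; rewrite !gt_eqF.
rewrite /theta expr2; apply: ler_pM => //; rewrite ?mulr_ge0 ?invr_ge0 ?ler0n ?(ltW a0)//.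
by rewrite ler_pM2l ?invr_gt0.
Qed.

Lemma sum_theta_depth n : \sum_(0 <= i < n) theta i ^+ 2 / (depth i)%:R <= 1.
Proof.
apply: (@le_trans _ _ (\sum_(0 <= i < n) (theta i - theta i.+1))).
  by apply: ler_sum => i _; exact: theta_depth_term.
under eq_bigr do rewrite -opprB.
rewrite sumrN telescope_sumr// opprB.
by have := theta_gt0 n; have := theta_le1 0; lra.
Qed.

(** The right-hand side doubles at each step, while the left-hand side grows by a factor of at most
    (6/5)^3 < 2. *)
Lemma cube_pow2 n : (4 * n.+4.+1 ^ 3 <= 2 ^ level n)%N.
Proof.
rewrite /level; elim: n => [|n IH]; first by rewrite (@leq_trans (2 ^ 9))// leq_exp2l.
rewrite addSn [(2 ^ _)%N]expnS; apply: leq_trans _ (leq_mul (leqnn 2) IH).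
rewrite !expnS expn0; nia.
Qed.

(** The width is at least 1 / (n + 5)^3, because [lgstep n] is at least 1 / (n + 5) and both
    logarithms are at most n + 5. *)
Lemma radius_width n : 4 * 2 ^- level n <= width n.
Proof.
have hl := lg_le n; have hl' := lg_le n.+1; have hs := lgstep_ge n.
apply: le_trans (_ : n.+4.+1%:R^-1 / (n.+4.+1%:R * n.+4.+1%:R) <= _).
  rewrite -invfM -[4]invrK -invfM lef_pV2 ?posrE ?mulr_gt0 ?invr_gt0 ?exprn_gt0 ?ltr0n//.
  rewrite ler_pdivlMl// -natrX -!natrM ler_nat; have := cube_pow2 n.
  by rewrite !expnS expn0 muln1 mulnA.
rewrite widthE; apply: ler_pM => //; rewrite ?invr_ge0 ?mulr_ge0//.
rewrite lef_pV2 ?posrE ?mulr_gt0 ?lg_gt0 ?ltr0n//.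
apply: ler_pM => //; rewrite ?(ltW (lg_gt0 _))//.
by apply: le_trans hl _; rewrite ler_nat; lia.
Qed.

Lemma radius_theta n : 2 ^- level n <= theta n.
Proof.
have := radius_width n; have := thetaS n; have := theta_gt0 n.+1.
have : 0 < 2 ^- level n :> R by rewrite invr_gt0 exprn_gt0.
lra.
Qed.

Lemma normc_node n : normc (node n) = 1.
Proof. exact: normc_cis. Qed.

(** This makes the discs around the nodes disjoint: a chord is at least half its angle, the angle is
    at least [width i], hence four times the larger of the two radii. *)
Lemma nodeB_ge i j : (i < j)%N -> 2 ^- level i + 2 ^- level j <= normc (node i - node j).
Proof.
move=> ij.
have h : width i <= theta i - theta j.
  by rewrite /width lerB// theta_decr.
have w0 := width_gt0 i.
have hA : `|theta i - theta j| = theta i - theta j by rewrite ger0_norm//; lra.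
apply: le_trans (_ : `|theta i - theta j| / 2 <= _); last first.
  apply: normc_cisB_ge; rewrite hA.
  by have := theta_le1 i; have := theta_gt0 j; lra.
rewrite hA; have := radius_width i.
have : 2 ^- level j <= 2 ^- level i :> R by apply: pow2_le; rewrite /level; lia.
lra.
Qed.

Lemma node_inj : injective node.
Proof.
have H i j : (i < j)%N -> node i <> node j.
  move=> /nodeB_ge h e; move: h; rewrite e subrr normc0.
  have h k : 0 < 2 ^- k :> R by rewrite invr_gt0 exprn_gt0.
  by have := h (level i); have := h (level j); lra.
move=> i j e; case: (ltngtP i j) => // /H; [exact|by move/(_ (esym e))].
Qed.

Lemma node_near1 n : normc (node n - 1) <= theta n.
Proof.
have -> : 1 = cis 0 :> R[i] by rewrite /cis cos0 sin0.
by apply: le_trans (normc_cisB_le _ _) _; rewrite subr0 gtr0_norm ?theta_gt0.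
Qed.

Lemma sum_pow2_level n : \sum_(0 <= i < n) 2 ^- level i <= 1 :> R.
Proof.
apply: le_trans (_ : \sum_(0 <= i < n) 2 ^- (16 + i) <= _).
  by apply: ler_sum => i _; rewrite /level addnC.
apply: le_trans (sum_pow2V _ 16 n) _.
have : 2 ^- 16 <= 2 ^- 1 :> R by exact: pow2_le.
have := pow2_ge0 R (16 + n); rewrite expr1; lra.
Qed.

Lemma sum_pow2_depth n : \sum_(0 <= i < n) 2 ^- depth i <= 2^-1 :> R.
Proof.
apply: le_trans (_ : \sum_(0 <= i < n) 2 ^- (16 + i) <= _).
  by apply: ler_sum => i _; apply: pow2_le; rewrite /depth /level; lia.
apply: le_trans (sum_pow2V _ 16 n) _.
have : 2 ^- 16 <= 2 ^- 2 :> R by exact: pow2_le.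
have := pow2_ge0 R (16 + n); lra.
Qed.

Lemma coef_le n : coef n <= 2 ^- depth n.
Proof.
rewrite lef_pV2 ?posrE ?exprn_gt0// lerXn2r ?nnegrE//; lra.
Qed.

Lemma sum_coef n : \sum_(0 <= i < n) coef i <= 2^-1.
Proof. by apply: le_trans (sum_pow2_depth n); apply: ler_sum => i _; exact: coef_le. Qed.

End Nodes.

(** * The infinite product and the potential *)

Section Outer.
Variable R : realType.
Implicit Types (z u q : R[i]) (e : R) (N n : nat).

(** The parameter [s] for which [gap s] vanishes at the node. *)
Definition pole n : R[i] := (node R n)^-1.

Lemma normc_pole n : normc (pole n) = 1.
Proof. by rewrite normcV normc_node invr1. Qed.

Definition dipn n := dip (depth n) (pole n).
Definition ddipn n := ddip (depth n) (pole n).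
Definition gapn n := gap (pole n).

Lemma normc_gapn n z : normc (gapn n z) = normc (z - node R n).
Proof. by rewrite /gapn normc_gap ?normc_pole// /pole invrK. Qed.

Lemma Re_gapn_gt0 n z : disc z -> 0 < complex.Re (gapn n z).
Proof. exact/Re_gap_gt0/normc_pole. Qed.

Lemma normc_gapn_gt0 n z : disc z -> 0 < normc (gapn n z).
Proof. by move=> z1; rewrite normc_gt0 Re_gt0_neq0// Re_gapn_gt0. Qed.

Lemma gapn_ge n z e : normc z <= 1 - e -> e <= normc (gapn n z).
Proof. by move=> ze; apply: le_trans (gap_ge z (normc_pole n)); lra. Qed.

Definition bprod N z : R[i] := \prod_(0 <= n < N) dipn n z.

(** The derivative of [bprod N], built by the product rule one factor at a time, so that no division
    by a factor occurs. *)
Fixpoint dbprod N z : R[i] :=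
  if N is n.+1 then dbprod n z * dipn n z + bprod n z * ddipn n z else 0.

Definition dsum N : R := \sum_(0 <= n < N) 2 ^- depth n.

Lemma bprodS N z : bprod N.+1 z = bprod N z * dipn N z.
Proof. by rewrite /bprod big_nat_recr. Qed.

Lemma dsumS N : dsum N.+1 = dsum N + 2 ^- depth N.
Proof. by rewrite /dsum big_nat_recr. Qed.

Lemma dsum_ge0 N : 0 <= dsum N.
Proof. by apply: sumr_ge0 => n _; exact: pow2_ge0. Qed.

Lemma dsum_le N : dsum N <= 2^-1.
Proof. exact: sum_pow2_depth. Qed.

Lemma dipn_le1 n z : disc z -> normc (dipn n z) <= 1.
Proof. by apply: dip_le1; rewrite ?depth_gt0 ?normc_pole. Qed.

Lemma bprod_le1 N z : disc z -> normc (bprod N z) <= 1.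
Proof.
move=> z1; elim: N => [|N IH]; first by rewrite /bprod big_geq// normc1.
by rewrite bprodS normcM mulr_ile1 ?normc_ge0// dipn_le1.
Qed.

Lemma bprod_le n N z : disc z -> (n < N)%N -> normc (bprod N z) <= normc (dipn n z).
Proof.
move=> z1; elim: N => // N IH; rewrite ltnS leq_eqVlt bprodS normcM => /predU1P[->|/IH h].
  by rewrite ler_piMl ?normc_ge0// bprod_le1.
by apply: le_trans h; rewrite ler_piMr ?normc_ge0// dipn_le1.
Qed.

Lemma dbprod_le N z : disc z -> normc (dbprod N z) <= \sum_(0 <= n < N) normc (ddipn n z).
Proof.
move=> z1; elim: N => [|N IH]; first by rewrite big_geq// normc0.
rewrite big_nat_recr//=; apply: le_trans (ler_normcD _ _) _.
apply: lerD; rewrite normcM; last by rewrite ler_piMl ?normc_ge0// bprod_le1.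
by apply: le_trans IH; rewrite ler_piMr ?normc_ge0// dipn_le1.
Qed.

Lemma one_sub_bprod_le N z : disc z ->
  normc (1 - bprod N z) <= \sum_(0 <= n < N) normc (1 - dipn n z).
Proof.
move=> z1; elim: N => [|N IH]; first by rewrite /bprod !big_geq// subrr normc0.
rewrite big_nat_recr//= bprodS.
rewrite (_ : _ - _ = (1 - bprod N z) + bprod N z * (1 - dipn N z)); last by ring.
apply: le_trans (ler_normcD _ _) _; apply: lerD => //.
by rewrite normcM ler_piMl ?normc_ge0// bprod_le1.
Qed.

Lemma ddipn_le_pow2 n z e : 0 < e -> normc z <= 1 - e ->
  normc (ddipn n z) <= 2 ^- depth n / e ^+ 2.
Proof.
move=> e0 ze; have z1 : disc z by rewrite /disc /=; lra.
apply: le_trans (ddip_le (depth_gt0 n) (normc_pole n) z1) _.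
rewrite ler_wpM2l ?pow2_ge0// lef_pV2 ?posrE ?exprn_gt0 ?normc_gapn_gt0//.
by rewrite lerXn2r ?nnegrE ?normc_ge0 ?gapn_ge ?(ltW e0).
Qed.

Lemma one_sub_dipn_le_pow2 n z e : 0 < e -> normc z <= 1 - e ->
  normc (1 - dipn n z) <= 2 ^- depth n / e.
Proof.
move=> e0 ze; have z1 : disc z by rewrite /disc /=; lra.
apply: le_trans (one_sub_dip_le (depth_gt0 n) (normc_pole n) z1) _.
by rewrite ler_wpM2l ?pow2_ge0// lef_pV2 ?posrE ?normc_gapn_gt0// gapn_ge.
Qed.

Lemma dbprod_le_dsum N z e : 0 < e -> normc z <= 1 - e ->
  normc (dbprod N z) <= dsum N / e ^+ 2.
Proof.
move=> e0 ze; have z1 : disc z by rewrite /disc /=; lra.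
apply: le_trans (dbprod_le _ z1) _; rewrite /dsum mulr_suml.
by apply: ler_sum => n _; exact: ddipn_le_pow2.
Qed.

Lemma bprodB_le N z u e : 0 < e -> normc z <= 1 - e -> normc (z + u) <= 1 - e ->
  normc (bprod N (z + u) - bprod N z) <= dsum N / e ^+ 2 * normc u.
Proof.
move=> e0 ze zue.
have z1 : disc z by rewrite /disc /=; lra.
have zu1 : disc (z + u) by rewrite /disc /=; lra.
elim: N => [|N IH].
  by rewrite /bprod /dsum !big_geq// subrr normc0 !mul0r.
rewrite !bprodS dsumS (_ : _ - _ = (bprod N (z + u) - bprod N z) * dipn N z
   + bprod N (z + u) * (dipn N (z + u) - dipn N z)); last by ring.
rewrite [in leRHS]mulrDl [leRHS]mulrDl; apply: le_trans (ler_normcD _ _) _.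
apply: lerD; rewrite normcM.
  by apply: le_trans IH; rewrite ler_piMr ?normc_ge0// dipn_le1.
apply: le_trans (dipB_le (depth_gt0 N) (normc_pole N) e0 ze zue).
by rewrite ler_piMl ?normc_ge0// bprod_le1.
Qed.

Lemma bprod_quadratic N z u e : 0 < e -> normc z <= 1 - e -> normc (z + u) <= 1 - e ->
  normc (bprod N (z + u) - bprod N z - u * dbprod N z) <=
    (dsum N / e ^+ 3 + dsum N ^+ 2 / e ^+ 4) * normc u ^+ 2.
Proof.
move=> e0 ze zue.
have z1 : disc z by rewrite /disc /=; lra.
have zu1 : disc (z + u) by rewrite /disc /=; lra.
elim: N => [|N IH].
  by rewrite /bprod /dsum !big_geq// mulr0 !subrr normc0 expr0n /= !mul0r addr0 mul0r.
rewrite /= !bprodS dsumS.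
have dq := dip_quadratic (depth_gt0 N) (normc_pole N) e0 ze zue.
have dl := bprodB_le N e0 ze zue.
have dd := ddipn_le_pow2 N e0 ze.
rewrite (_ : _ - _ = (bprod N (z + u) - bprod N z - u * dbprod N z) * dipn N z
   + bprod N (z + u) * (dipn N (z + u) - dipn N z - u * ddipn N z)
   + (bprod N (z + u) - bprod N z) * (u * ddipn N z)); last by ring.
set t : R := 2 ^- depth N; have t0 : 0 <= t := pow2_ge0 R _.
have d0 := dsum_ge0 N; set s := dsum N in IH dl d0 *.
apply: (@le_trans _ _ ((s / e ^+ 3 + s ^+ 2 / e ^+ 4) * normc u ^+ 2
    + t / e ^+ 3 * normc u ^+ 2 + (s / e ^+ 2 * normc u) * (normc u * (t / e ^+ 2)))).
  apply: le_trans (ler_normcD _ _) _; apply: lerD; last first.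
    by rewrite normcM [normc (u * _)]normcM ler_pM ?mulr_ge0 ?normc_ge0// ler_wpM2l ?normc_ge0.
  apply: le_trans (ler_normcD _ _) _; apply: lerD; rewrite normcM.
    by apply: le_trans IH; rewrite ler_piMr ?normc_ge0// dipn_le1.
  by apply: le_trans dq; rewrite ler_piMl ?normc_ge0// bprod_le1.
(* The product of increments costs s t, which fits into the growth 2 s t + t^2 of the squared
   sum. *)
rewrite -subr_ge0 (_ : _ - _ = (s * t + t ^+ 2) / e ^+ 4 * normc u ^+ 2).
  by rewrite !mulr_ge0 ?invr_ge0 ?exprn_ge0 ?normc_ge0 ?addr_ge0 ?mulr_ge0 ?(ltW e0).
by field; rewrite gt_eqF.
Qed.

Lemma bprod_increment N z e : 0 < e -> normc z <= 1 - e ->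
  normc (bprod N.+1 z - bprod N z) <= 2 ^- depth N / e.
Proof.
move=> e0 ze; have z1 : disc z by rewrite /disc /=; lra.
rewrite bprodS (_ : _ - _ = - (bprod N z * (1 - dipn N z))); last by ring.
rewrite normc_opp normcM; apply: le_trans (one_sub_dipn_le_pow2 N e0 ze).
by rewrite ler_piMl ?normc_ge0// bprod_le1.
Qed.

Lemma dbprod_increment N z e : 0 < e -> normc z <= 1 - e ->
  normc (dbprod N.+1 z - dbprod N z) <= 2 ^- depth N * (e ^- 3 + e ^- 2).
Proof.
move=> e0 ze; have z1 : disc z by rewrite /disc /=; lra.
rewrite /= (_ : _ - _ = - (dbprod N z * (1 - dipn N z)) + bprod N z * ddipn N z); last by ring.
have t0 : 0 <= 2 ^- depth N :> R := pow2_ge0 R _.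
apply: le_trans (ler_normcD _ _) _; rewrite normc_opp [leRHS]mulrDr; apply: lerD.
  rewrite normcM; apply: le_trans (ler_pM _ _ (dbprod_le_dsum N e0 ze) (one_sub_dipn_le_pow2 N e0 ze)) _;
    rewrite ?normc_ge0//.
  set t : R := 2 ^- depth N in t0 *.
  have -> : dsum N / e ^+ 2 * (t / e) = dsum N * (t * e ^- 3) by field; rewrite gt_eqF.
  rewrite ler_piMl ?mulr_ge0 ?invr_ge0 ?exprn_ge0 ?(ltW e0)//.
  by apply: le_trans (dsum_le N) _; lra.
rewrite normcM; apply: le_trans (ddipn_le_pow2 N e0 ze).
by rewrite ler_piMl ?normc_ge0// bprod_le1.
Qed.

Lemma disc_margin z : disc z -> exists2 e, 0 < e & forall u, normc u < e ->
  normc (z + u) <= 1 - e.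
Proof.
rewrite /disc /= => z1; exists ((1 - normc z) / 2); first by lra.
by move=> u ue; have := ler_normcD z u; lra.
Qed.

Lemma disc_margin0 z e : (forall u, normc u < e -> normc (z + u) <= 1 - e) -> 0 < e ->
  normc z <= 1 - e.
Proof. by move=> h e0; have := h 0; rewrite normc0 addr0; exact. Qed.

Lemma disc_of_margin z e : 0 < e -> normc z <= 1 - e -> disc z.
Proof. by rewrite /disc /=; lra. Qed.

(* Equal to [0] if the product diverges, which does not happen on the disc. *)
Definition bprod_inf z : R[i] := xget 0 [set l | clim (bprod ^~ z) l].

Lemma bprod_clim z : disc z -> clim (bprod ^~ z) (bprod_inf z).
Proof.
move=> z1; have [e e0 he] := disc_margin z1; have ze := disc_margin0 he e0.
rewrite /bprod_inf; apply: (@xgetPex _ 0 [set l | clim (bprod ^~ z) l]).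
apply: (@clim_of_summable_increments _ _ (fun n => 2 ^- depth n / e) (2^-1 / e)).
  by move=> n; exact: bprod_increment.
by move=> n; rewrite -mulr_suml ler_wpM2r ?invr_ge0 ?(ltW e0)// dsum_le.
Qed.

Lemma bprod_inf_expands z : disc z -> exists q,
  [/\ expands bprod_inf z q & clim (dbprod ^~ z) q].
Proof.
move=> z1; have [e e0 he] := disc_margin z1; have ze := disc_margin0 he e0.
have [q hq] : exists q, clim (dbprod ^~ z) q.
  apply: (@clim_of_summable_increments _ _ (fun n => 2 ^- depth n * (e ^- 3 + e ^- 2))
    (2^-1 * (e ^- 3 + e ^- 2))).
    by move=> n; exact: dbprod_increment.
  move=> n; rewrite -mulr_suml ler_wpM2r ?dsum_le//.
  by rewrite addr_ge0// invr_ge0 exprn_ge0// ltW.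
exists q; split => //.
apply: (@clim_expands _ bprod (dbprod ^~ z) _ _ _ (e ^- 3 + e ^- 4) e) => //.
- by rewrite addr_ge0// invr_ge0 exprn_ge0// ltW.
- by move=> u /he/(disc_of_margin e0)/bprod_clim.
move=> n u /he zue; apply: le_trans (bprod_quadratic n e0 ze zue) _.
rewrite ler_wpM2r ?exprn_ge0 ?normc_ge0//.
have d1 : dsum n <= 1 by apply: le_trans (dsum_le n) _; lra.
by apply: lerD; rewrite ler_piMl ?invr_ge0 ?exprn_ge0 ?(ltW e0)// exprn_ile1// dsum_ge0.
Qed.

Lemma bprod_inf_le n z : disc z -> normc (bprod_inf z) <= normc (dipn n z).
Proof.
move=> z1; apply: (clim_normc_le (bprod_clim z1) (N := n.+1)) => N nN.
exact: bprod_le.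
Qed.

Lemma bprod_inf_le1 z : disc z -> normc (bprod_inf z) <= 1.
Proof. by move=> z1; apply: le_trans (bprod_inf_le 0 z1) _; exact: dipn_le1. Qed.

(** At the origin the margin is [e = 1], so the factors differ from 1 by at most 2 ^- depth, and
    these numbers sum to at most 1/2. *)
Lemma bprod_inf0_neq0 : bprod_inf 0 != 0.
Proof.
have d0 : disc (0 : R[i]) by change (normc (0 : R[i]) < 1); rewrite normc0.
have : normc (1 - bprod_inf 0) <= 2^-1.
  apply: (@clim_normc_le _ (fun N => 1 - bprod N 0) _ _ 0).
    by apply: climB; [exact: clim_cst|exact: bprod_clim].
  move=> N _; apply: le_trans (one_sub_bprod_le _ d0) _.
  apply: le_trans (dsum_le N); apply: ler_sum => n _.
  have := @one_sub_dipn_le_pow2 n 0 1; rewrite divr1 normc0 subrr; exact.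
by apply: contraTneq => ->; rewrite subr0 normc1 -ltNge; lra.
Qed.

(** With w = 1 - z / tau, the expression 2 / w - 1 is the Herglotz kernel (tau + z) / (tau - z). *)
Definition potential_term n z : R[i] := (coef R n)%:C * (2 / gapn n z - 1).
Definition dpotential_term n z : R[i] := (coef R n)%:C * (2 * pole n / gapn n z ^+ 2).
Definition potential N z := \sum_(0 <= n < N) potential_term n z.
Definition dpotential N z := \sum_(0 <= n < N) dpotential_term n z.

Lemma normc_coef n : normc (coef R n)%:C = coef R n.
Proof. by rewrite normc_real ger0_norm// ltW// coef_gt0. Qed.

Lemma normc2 : normc (2 : R[i]) = 2.
Proof. by rewrite (_ : 2 = (2 : R)%:C) ?normc_real ?ger0_norm// rmorph_nat. Qed.

Lemma potential_term_quadratic n z u e :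
  0 < e -> normc z <= 1 - e -> normc (z + u) <= 1 - e ->
  normc (potential_term n (z + u) - potential_term n z - u * dpotential_term n z) <=
    coef R n * (2 / e ^+ 3 * normc u ^+ 2).
Proof.
move=> e0 ze zue.
have := normc_inv_quadratic e0 (gapn_ge n ze) (gapn_ge n zue).
have -> : gapn n (z + u) - gapn n z = - (pole n * u) by rewrite /gapn gapD; ring.
rewrite normc_opp normcM normc_pole mul1r => hq.
rewrite /potential_term /dpotential_term.
rewrite (_ : _ - _ - _ = (coef R n)%:C * (2 * ((gapn n (z + u))^-1 - (gapn n z)^-1
   + - (pole n * u) / gapn n z ^+ 2))); last by ring.
rewrite normcM normcM normc_coef normc2 ler_wpM2l ?(ltW (coef_gt0 R n))//.
by rewrite -mulrA [e ^- 3 * _]mulrC ler_wpM2l.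
Qed.

Lemma potential_quadratic N z u e :
  0 < e -> normc z <= 1 - e -> normc (z + u) <= 1 - e ->
  normc (potential N (z + u) - potential N z - u * dpotential N z) <=
    2^-1 * (2 / e ^+ 3 * normc u ^+ 2).
Proof.
move=> e0 ze zue; rewrite /potential /dpotential mulr_sumr -!sumrB.
apply: le_trans (ler_normc_sum _ _ _) _.
apply: (@le_trans _ _ (\sum_(0 <= n < N) coef R n * (2 / e ^+ 3 * normc u ^+ 2))).
  by apply: ler_sum => n _; exact: potential_term_quadratic.
rewrite -mulr_suml ler_wpM2r ?sum_coef//.
by rewrite !mulr_ge0 ?invr_ge0 ?exprn_ge0 ?normc_ge0// ltW.
Qed.

Lemma dpotential_term_le n z : disc z ->
  normc (dpotential_term n z) <= coef R n * (2 / normc (gapn n z) ^+ 2).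
Proof.
move=> z1; rewrite /dpotential_term normcM normc_coef normcM normcM normc2 normc_pole mulr1.
by rewrite normcV normcX.
Qed.

Lemma potential_expands (F : R[i] -> R[i]) z :
  (forall z, disc z -> clim (potential ^~ z) (F z)) -> disc z ->
  exists q, [/\ expands F z q & clim (dpotential ^~ z) q].
Proof.
move=> hF z1; have [e e0 he] := disc_margin z1; have ze := disc_margin0 he e0.
have [q hq] : exists q, clim (dpotential ^~ z) q.
  apply: (@clim_of_summable_increments _ _ (fun n => coef R n * (2 / e ^+ 2))
    (2^-1 * (2 / e ^+ 2))).
    move=> n; rewrite /dpotential big_nat_recr//= addrAC subrr add0r.
    apply: le_trans (dpotential_term_le n z1) _.
    rewrite ler_wpM2l ?(ltW (coef_gt0 R n))// ler_wpM2l//.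
    rewrite lef_pV2 ?posrE ?exprn_gt0 ?normc_gapn_gt0//.
    by rewrite lerXn2r ?nnegrE ?normc_ge0 ?gapn_ge ?(ltW e0).
  move=> n; rewrite -mulr_suml ler_wpM2r ?sum_coef//.
  by rewrite mulr_ge0// invr_ge0 exprn_ge0// ltW.
exists q; split => //.
apply: (@clim_expands _ potential (dpotential ^~ z) _ _ _ (2^-1 * (2 / e ^+ 3)) e) => //.
- by rewrite !mulr_ge0 ?invr_ge0 ?exprn_ge0// ltW.
- by move=> u /he/(disc_of_margin e0)/hF.
by move=> n u /he zue; rewrite -mulrA; exact: potential_quadratic.
Qed.

(** The real part of 2 / w - 1 is the Poisson kernel (1 - |1 - w|^2) / |w|^2, and |1 - w| = |z|. *)
Lemma Re_potential_term_ge0 n z : disc z -> 0 <= complex.Re (potential_term n z).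
Proof.
move=> z1; have w0 := normc_gapn_gt0 n z1.
have hz : normc (1 - gapn n z) < 1.
  by rewrite /gapn /gap subKr normcM normc_pole mul1r.
have := normc_sqr (gapn n z); have := normc_sqr (1 - gapn n z).
have : normc (1 - gapn n z) ^+ 2 < 1 by rewrite expr_lt1// normc_ge0.
set w := gapn n z in w0 *.
have -> : complex.Re (potential_term n z) =
    coef R n * (2 * complex.Re w / normc w ^+ 2 - 1).
  rewrite /potential_term -/w normc_sqr; clearbody w; case: w {w0 hz} => x y /=.
  by rewrite !(mul0r, mulr0, subr0, addr0, oppr0); ring.
have -> : complex.Re (1 - w) = 1 - complex.Re w by case: (w).
have -> : complex.Im (1 - w) = - complex.Im w by case: (w) => x y /=; rewrite sub0r.
move=> h1 E1 E2; rewrite mulr_ge0 ?(ltW (coef_gt0 R n))// subr_ge0.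
rewrite ler_pdivlMr ?exprn_gt0// mul1r E2; move: h1; rewrite E1 sqrrN; nra.
Qed.

(** The square cancels the double poles of the derivative of the potential. The factor 1 - z is
    small where the nodes accumulate, and turns the divergent sum of 1 / [depth n] into that of
    [theta n ^+ 2 / depth n]. *)
Definition outer_part z : R[i] := (1 - z) * (bprod_inf z * bprod_inf z).

(** The double pole of the n-th term is cancelled by the square of the n-th dip alone, at the cost
    of 16 ^ depth; the mass absorbs this and leaves 2 * 2 ^- depth. *)
Lemma sum_dpotential_bprod N z : disc z ->
  normc (dpotential N z * (bprod_inf z * bprod_inf z)) <= 1.
Proof.
move=> z1; rewrite normcM; set b := normc (_ * _).
apply: (@le_trans _ _ (\sum_(0 <= n < N) normc (dpotential_term n z) * b)).
  by rewrite -mulr_suml ler_wpM2r ?normc_ge0// ler_normc_sum.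
apply: (@le_trans _ _ (\sum_(0 <= n < N) 2 * 2 ^- depth n)); last first.
  by rewrite -mulr_sumr; have := dsum_le N; rewrite /dsum; lra.
apply: ler_sum => n _; have w0 := normc_gapn_gt0 n z1.
have bw : b <= 16 ^+ depth n * normc (gapn n z) ^+ 2.
  apply: (@le_trans _ _ ((4 ^+ depth n * normc (gapn n z)) ^+ 2)).
    have h : normc (bprod_inf z) <= 4 ^+ depth n * normc (gapn n z).
      apply: le_trans (bprod_inf_le n z1) _.
      have := dip_le (depth_gt0 n) (normc_pole n) z1; rewrite -/(dipn n z); exact.
    by rewrite /b normcM -expr2 lerXn2r ?nnegrE ?normc_ge0 ?mulr_ge0 ?exprn_ge0 ?normc_ge0.
  rewrite exprMn -exprM mulnC exprM (_ : 4 ^+ 2 = 16 :> R)//; ring.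
apply: (@le_trans _ _ (coef R n * (2 / normc (gapn n z) ^+ 2) * (16 ^+ depth n * normc (gapn n z) ^+ 2))).
  by apply: ler_pM => //; rewrite ?normc_ge0// dpotential_term_le.
rewrite /coef (_ : 32 = 16 * 2 :> R); last by ring.
rewrite exprMn le_eqVlt; apply/orP; left; apply/eqP; field.
by rewrite (gt_eqF w0) !gt_eqF ?exprn_gt0.
Qed.

(** * The derivative of the candidate function *)

Section Factor.
(** [F] stands for the Herglotz integral of the measure; here it is known only as the pointwise
    limit of the partial potentials on the disc. *)
Variable F : R[i] -> R[i].
Hypothesis hF : forall z, disc z -> clim (potential ^~ z) (F z).

Lemma Re_potential_ge0 z : disc z -> 0 <= complex.Re (F z).
Proof.
move=> z1.
have h : complex.Re (- F z) <= 0.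
  apply: (clim_Re_le (climN (hF z1))) => N.
  have : 0 <= complex.Re (potential N z).
    by rewrite Re_sum; apply: sumr_ge0 => n _; exact: Re_potential_term_ge0.
  by case: (potential N z) => x y /=; rewrite oppr_le0.
by move: h; case: (F z) => x y /=; rewrite oppr_le0.
Qed.

Lemma inner_part_le1 z : disc z -> normc (cexp (- F z)) <= 1.
Proof.
move=> z1; rewrite normc_cexp -[leRHS]expR0 ler_expR.
by have := Re_potential_ge0 z1; case: (F z) => x y /=; rewrite oppr_le0.
Qed.

Lemma expandsN (f : R[i] -> R[i]) z q : expands f z q -> expands (fun x => - f x) z (- q).
Proof.
move=> [B [d [B0 d0 h]]]; exists B, d; split => // u /h.
by rewrite -normc_opp; congr (normc _ <= _); ring.
Qed.

Lemma inner_part_expands z : disc z -> exists q,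
  expands (fun x => cexp (- F x)) z (cexp (- F z) * - q) /\ clim (dpotential ^~ z) q.
Proof.
move=> z1; have [q [eq1 hq]] := potential_expands hF z1.
by exists q; split => //; exact/expands_cexp_comp/expandsN.
Qed.

Lemma outer_part_expands z : disc z -> exists q,
  expands outer_part z (- 1 * (bprod_inf z * bprod_inf z)
    + (1 - z) * (q * bprod_inf z + bprod_inf z * q)) /\ clim (dbprod ^~ z) q.
Proof.
move=> z1; have [q [eq1 hq]] := bprod_inf_expands z1.
exists q; split => //; apply: expandsM; last exact: expandsM.
have := @expands_linear _ 1 (-1) z.
by rewrite (_ : (fun x => _) = (fun x => 1 - x))//; apply/funext => x; rewrite mulN1r.
Qed.

Lemma normc_one_sub z : disc z -> normc (1 - z) <= 2.
Proof. by rewrite /disc /= => z1; have := ler_normcB 1 z; rewrite normc1; lra. Qed.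

Lemma outer_part_le2 z : disc z -> normc (outer_part z) <= 2.
Proof.
move=> z1; rewrite /outer_part normcM -[2]mulr1 ler_pM ?normc_ge0 ?normc_one_sub//.
by rewrite normcM mulr_ile1 ?normc_ge0 ?bprod_inf_le1.
Qed.

(** With E the inner function and b the infinite product, the derivative is E (- (1 - z) F' b^2 -
    b^2 + 2 (1 - z) b' b). The first two terms are bounded by 2 and 1, and [p] is b'. *)
Lemma product_expands z : disc z -> exists q,
  [/\ expands (fun x => cexp (- F x) * outer_part x) z q &
   exists2 p, clim (dbprod ^~ z) p & normc q <= 3 + 2 * (normc (1 - z) * normc p)].
Proof.
move=> z1; have [q1 [e1 h1]] := inner_part_expands z1.
have [q2 [e2 h2]] := outer_part_expands z1.
eexists; split; first exact: expandsM e1 e2.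
exists q2 => //; set b := bprod_inf z; set E := cexp (- F z).
have E1 : normc E <= 1 := inner_part_le1 z1.
have b1 : normc b <= 1 := bprod_inf_le1 z1.
have bb1 : normc (b * b) <= 1 by rewrite normcM mulr_ile1 ?normc_ge0.
have qb : normc (q1 * (b * b)) <= 1.
  apply: (@clim_normc_le _ (fun N => b * b * dpotential N z) _ _ 0).
    by rewrite [q1 * _]mulrC; exact: climMl.
  by move=> N _; rewrite [_ * dpotential N z]mulrC; exact: sum_dpotential_bprod.
rewrite /outer_part -/b (_ : _ + _ = E * (- (1 - z) * (q1 * (b * b)) + - (b * b)
   + 2 * ((1 - z) * q2) * b)); last by ring.
rewrite normcM; set X := _ + _ : R[i].
apply: (@le_trans _ _ (normc X)); first by rewrite ler_piMl ?normc_ge0.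
apply: le_trans (ler_normcD _ _) _; apply: lerD.
  apply: le_trans (ler_normcD _ _) _; rewrite (_ : 3 = 2 * 1 + 1); last by ring.
  apply: lerD; last by rewrite normc_opp.
  rewrite normcM normc_opp ler_pM ?normc_ge0// normc_one_sub//.
rewrite normcM; apply: (@le_trans _ _ (normc (2 * ((1 - z) * q2)))).
  by rewrite ler_piMr ?normc_ge0.
by rewrite normcM normcM normc2.
Qed.

(** Outside the disc of radius r = 2 ^- level the derivative of the dip is at most r^4 / |w|^2 <= r,
    and the radii sum to at most 1. *)
Lemma far_sum_le N z (P : pred nat) : disc z ->
  (forall n, P n -> 2 ^- level n <= normc (gapn n z)) ->
  \sum_(0 <= n < N | P n) normc (ddipn n z) <= 1.
Proof.
move=> z1 hP; apply: le_trans (@sum_pow2_level R N).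
apply: (@le_trans _ _ (\sum_(0 <= n < N | P n) 2 ^- level n)).
  apply: ler_sum => n /hP h.
  apply: le_trans (ddip_le (depth_gt0 n) (normc_pole n) z1) _.
  rewrite ler_pdivrMr ?exprn_gt0 ?normc_gapn_gt0//.
  apply: (@le_trans _ _ (2 ^- level n * (2 ^- level n) ^+ 2)); last first.
    by rewrite ler_wpM2l ?pow2_ge0// lerXn2r ?nnegrE ?pow2_ge0 ?normc_ge0.
  rewrite -exprS exprVn -exprM; apply: pow2_le; rewrite /depth; lia.
rewrite [leRHS](bigID P)/= lerDl.
by apply: sumr_ge0 => n _; exact: pow2_ge0.
Qed.

Lemma near_unique z i j :
  normc (gapn i z) < 2 ^- level i -> normc (gapn j z) < 2 ^- level j -> i = j.
Proof.
rewrite !normc_gapn => hi hj; case: (ltngtP i j) => // /(@nodeB_ge R) h; exfalso.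
  by have := ler_normc_dist z (node R i) (node R j); rewrite [normc (node R i - z)]normc_subC; lra.
by have := ler_normc_dist z (node R j) (node R i); rewrite [normc (node R j - z)]normc_subC; lra.
Qed.

(** At most one node is near [z]; the other dips contribute at most 1 together, hence 2 after
    multiplication by |1 - z|. Near node n, |1 - z| is at most [theta n] plus the radius, so at most
    [2 * theta n], and [ddip_near] supplies the rest. *)
Lemma weighted_dbprod_le z : disc z ->
  (forall N, normc (1 - z) * normc (dbprod N z) <= 2) \/
  exists n l, [/\ (l <= 2 * depth n)%N, normc (gapn n z) < 2 ^- l &
   forall N, normc (1 - z) * normc (dbprod N z) <=
     2 + 12 * theta R n / (depth n)%:R * 2 ^+ l].
Proof.
move=> z1; have z2 := normc_one_sub z1.
have [[n hn]|no] := pselect (exists n, normc (gapn n z) < 2 ^- level n); last first.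
  left => N; apply: (@le_trans _ _ (2 * 1)); last by rewrite mulr1.
  apply: ler_pM; rewrite ?normc_ge0//; apply: le_trans (dbprod_le _ z1) _.
  apply: (@far_sum_le N z xpredT z1) => n _.
  by rewrite leNgt; apply/negP => h; apply: no; exists n.
right; have w1 : normc (gapn n z) < 1.
  by apply: lt_le_trans hn _; rewrite invf_le1 ?exprn_gt0// exprn_ege1// ler1n.
have [l [l2 hl hd]] := ddip_near (depth_gt0 n) (normc_pole n) z1 w1.
exists n, l; split => // N.
have zn : normc (1 - z) <= 2 * theta R n.
  have := ler_normc_dist (node R n) 1 z; have := node_near1 R n.
  rewrite [normc (node R n - 1)]normc_subC [normc (node R n - z)]normc_subC -[normc (z - _)]normc_gapn.
  by have := radius_theta R n; lra.
have far : \sum_(0 <= i < N | i != n) normc (ddipn i z) <= 1.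
  apply: far_sum_le => // i /eqP ni; rewrite leNgt; apply/negP => h.
  by apply: ni; exact: near_unique h hn.
have split_sum : \sum_(0 <= i < N) normc (ddipn i z) <= 1 + normc (ddipn n z).
  rewrite (bigID (fun i => i != n))/=; apply: lerD => //.
  under eq_bigl do rewrite negbK.
  rewrite big_nat1_eq; case: ifP => // _; exact: normc_ge0.
apply: (@le_trans _ _ (normc (1 - z) * (1 + normc (ddipn n z)))).
  rewrite ler_wpM2l ?normc_ge0//; exact: le_trans (dbprod_le _ z1) split_sum.
rewrite mulrDr mulr1; apply: lerD => //.
have -> : 12 * theta R n / (depth n)%:R * 2 ^+ l =
   (2 * theta R n) * (6 / (depth n)%:R * 2 ^+ l) by ring.
by apply: ler_pM; rewrite ?normc_ge0.
Qed.

(** With x = (theta / depth) * 2^l, the modulus of [q] is at most 3 + 2 (2 + 12 x) = 7 + 24 x, whose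
    square is at most 2 * 7^2 + 2 * 24^2 x^2. *)
Lemma product_derive_bound z q : disc z ->
  expands (fun x => cexp (- F x) * outer_part x) z q ->
  normc q ^+ 2 <= 98 \/ exists n l, [/\ (l <= 2 * depth n)%N,
    normc (gapn n z) < 2 ^- l &
    normc q ^+ 2 <= 98 + 2 * 24 ^+ 2 * (theta R n / (depth n)%:R) ^+ 2 * 4 ^+ l].
Proof.
move=> z1 eq; have [q' [eq' [p hp hq]]] := product_expands z1.
have -> : q = q' by rewrite -(expands_derive1 eq) (expands_derive1 eq').
have lim (B : R) : (forall N, normc (1 - z) * normc (dbprod N z) <= B) ->
    normc (1 - z) * normc p <= B.
  move=> h; rewrite -normcM; apply: (@clim_normc_le _ (fun N => (1 - z) * dbprod N z) _ _ 0).
    exact: climMl.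
  by move=> N _; rewrite normcM.
have q0 := normc_ge0 q'.
case: (weighted_dbprod_le z1) => [/lim h|[n [l [l2 hl /lim h]]]].
  left; have : normc q' <= 7 by lra.
  by move: q0; nra.
right; exists n, l; split => //.
set t := theta R n / (depth n)%:R in h *.
have t0 : 0 <= t by rewrite mulr_ge0 ?(ltW (theta_gt0 R n))// invr_ge0 ler0n.
have E : 4 ^+ l = (2 ^+ l) ^+ 2 :> R by rewrite exprAC expr2; congr (_ ^+ _); ring.
have l0 : 0 <= 2 ^+ l :> R by rewrite exprn_ge0.
have h' : normc q' <= 7 + 24 * (t * 2 ^+ l).
  by move: h; rewrite -[12 * _ / _]mulrA -/t -[12 * t * _]mulrA; lra.
rewrite E -mulrA -exprMn; set x := t * 2 ^+ l in h' *.
have x0 : 0 <= x by rewrite mulr_ge0.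
apply: (@le_trans _ _ ((7 + 24 * x) ^+ 2)).
  by rewrite lerXn2r ?nnegrE// addr_ge0// mulr_ge0.
rewrite -subr_ge0 (_ : _ - _ = (7 - 24 * x) ^+ 2) ?sqr_ge0//; ring.
Qed.

End Factor.
End Outer.

(** * Finiteness of the Dirichlet integral *)

Section DirichletIntegral.
Variable R : realType.

(* No measurability is needed, since the integral of a nonnegative function is a
   supremum over the simple functions below it. *)
Lemma ge0_le_integral_dominated d (T : measurableType d) (mu : {measure set T -> \bar R})
    (D D' : set T) (f g : T -> \bar R) : D `<=` D' ->
  (forall x, D x -> (0 <= f x)%E) -> (forall x, D' x -> (0 <= g x)%E) ->
  (forall x, D x -> (f x <= g x)%E) ->
  (\int[mu]_(x in D) f x <= \int[mu]_(x in D') g x)%E.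
Proof.
move=> DD' f0 g0 fg; rewrite !ge0_integralE//.
apply: ge_ereal_sup => _ [h hf <-]; apply: ereal_sup_ubound; exists h => // x.
apply: le_trans (hf x) _; rewrite /patch; case: ifPn => [|_].
  by rewrite inE => Dx; rewrite mem_set ?fg//; exact: DD'.
by case: ifPn => //; rewrite inE => /g0.
Qed.

Lemma nneseries_le (u : nat -> \bar R) (B : \bar R) : (forall n, (0 <= u n)%E) ->
  (forall n, (\sum_(0 <= i < n) u i <= B)%E) -> (\sum_(0 <= i <oo) u i <= B)%E.
Proof.
move=> u0 uB; apply: lime_le; first exact: is_cvg_nneseries.
exact: nearW.
Qed.

Lemma nneseries_ge_term (u : nat -> \bar R) (n : nat) : (forall n, (0 <= u n)%E) ->
  (u n <= \sum_(0 <= i <oo) u i)%E.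
Proof.
move=> u0; apply: le_trans (nneseries_lim_ge n.+1 (fun i _ _ => u0 i)).
by rewrite big_nat_recr//= leeDr// sume_ge0.
Qed.

Notation plane := (measurableTypeR R * measurableTypeR R)%type.

(** Squares replace discs because the product measure of a product of intervals is immediate. *)
Definition square (c : R[i]) (r : R) : set plane :=
  ball (complex.Re c) r `*` ball (complex.Im c) r.

Lemma measurable_ballR (a r : R) : measurable (ball a r : set R).
Proof. by rewrite ball_itv; exact: measurable_itv. Qed.

Lemma measurable_square c r : measurable (square c r).
Proof. by apply: measurableX; exact: measurable_ballR. Qed.

Notation plane_measure := ((@lebesgue_measure R) \x (@lebesgue_measure R))%E.

Lemma square_area c (r : R) : 0 <= r -> plane_measure (square c r) = (4 * r ^+ 2)%:E.
Proof.
move=> r0; rewrite /square product_measure1E; try exact: measurable_ballR.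
transitivity ((r *+ 2)%:E * (r *+ 2)%:E)%E.
  by congr (_ * _)%E; exact: lebesgue_measure_ball.
by rewrite -EFinM; congr (_%:E); ring.
Qed.

Lemma square_mem (c : R[i]) (r x y : R) : normc ((x +i* y) - c) < r -> square c r (x, y).
Proof.
move=> h; split; rewrite /ball /= distrC.
  by apply: le_lt_trans h; apply: le_trans (ler_normc_Re _); case: c.
by apply: le_lt_trans h; apply: le_trans (ler_normc_Im _); case: c.
Qed.

Definition tile (k : R) (c : R[i]) (r : R) (p : plane) : \bar R :=
  (k%:E * (\1_(square c r) p)%:E)%E.

Lemma tile_ge0 k c r p : 0 <= k -> (0 <= tile k c r p)%E.
Proof. by move=> k0; rewrite mule_ge0// lee_fin. Qed.

Lemma measurable_tile k c r : measurable_fun [set: plane] (tile k c r).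
Proof.
have mS := measurable_square c r.
by apply: measurable_funeM; apply/measurable_EFinP; exact: measurable_indic.
Qed.

Lemma integral_tile k c r : 0 <= k -> 0 <= r ->
  (\int[plane_measure]_p tile k c r p = (k * (4 * r ^+ 2))%:E)%E.
Proof.
move=> k0 r0; have mS := measurable_square c r.
rewrite ge0_integralZl_EFin//; last by apply/measurable_EFinP; exact: measurable_indic.
by rewrite integral_indic// setIT EFinM; congr (_ * _)%E; exact: square_area.
Qed.

Lemma tile_mem k c r p : square c r p -> tile k c r p = k%:E.
Proof. by move=> h; rewrite /tile indicE mem_set// mule1. Qed.

(** The excess over 98 allowed by [product_derive_bound] at distance less than 2 ^- l from node
    n. *)
Definition tile_weight (n l : nat) : R := 2 * 24 ^+ 2 * (theta R n / (depth n)%:R) ^+ 2 * 4 ^+ l.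

Lemma tile_weight_ge0 n l : 0 <= tile_weight n l.
Proof.
apply: mulr_ge0; last by rewrite exprn_ge0.
apply: mulr_ge0; last exact: sqr_ge0.
by apply: mulr_ge0 => //; rewrite exprn_ge0.
Qed.

Definition tiles (n : nat) (p : plane) : \bar R :=
  (\sum_(l <- iota 0 (2 * depth n).+1) tile (tile_weight n l) (node R n) (2 ^- l) p)%E.

Lemma tiles_ge0 n p : (0 <= tiles n p)%E.
Proof. by apply: sume_ge0 => l _; rewrite tile_ge0// tile_weight_ge0. Qed.

Lemma measurable_tiles n : measurable_fun [set: plane] (tiles n).
Proof. by apply: emeasurable_sum => l; exact: measurable_tile. Qed.

(** Weight 4^l and area 4 * 4^-l compensate, so every scale contributes the same amount 8 * 24^2
    (theta / depth)^2, and there are 2 depth + 1 <= 3 depth scales. *)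
Lemma integral_tiles n :
  (\int[plane_measure]_p tiles n p <= (24 ^+ 3 * (theta R n ^+ 2 / (depth n)%:R))%:E)%E.
Proof.
rewrite ge0_integral_sum//; last 2 first.
- by move=> l; exact: measurable_tile.
- by move=> l p _; rewrite tile_ge0// tile_weight_ge0.
set t := theta R n; set m := (depth n)%:R : R.
have m0 : 0 < m by rewrite ltr0n depth_gt0.
apply: (@le_trans _ _ (\sum_(l <- iota 0 (2 * depth n).+1) (8 * 24 ^+ 2 * (t / m) ^+ 2)%:E)%E).
  apply: lee_sum => l _; rewrite integral_tile ?tile_weight_ge0 ?pow2_ge0// lee_fin.
  rewrite /tile_weight -/t -/m le_eqVlt; apply/orP; left; apply/eqP.
  have -> : 4 ^+ l = (2 ^+ l) ^+ 2 :> R by rewrite exprAC expr2; congr (_ ^+ _); ring.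
  by field; rewrite !gt_eqF ?exprn_gt0.
rewrite sumEFin lee_fin big_const_seq count_predT size_iota iter_addr_0.
rewrite -[_ *+ _]mulr_natr.
have -> : 24 ^+ 3 * (t ^+ 2 / m) = 8 * 24 ^+ 2 * (t / m) ^+ 2 * (3 * m) by field; rewrite gt_eqF.
apply: ler_wpM2l.
  apply: mulr_ge0; last exact: sqr_ge0.
  by apply: mulr_ge0 => //; rewrite exprn_ge0.
by rewrite /m -natrM ler_nat; have := depth_gt0 n; lia.
Qed.

Lemma area_integral_lty (D : R[i] -> R) : (forall z, 0 <= D z) ->
  (forall z, disc z -> D z <= 98 \/ exists n l, [/\ (l <= 2 * depth n)%N,
    normc (z - node R n) < 2 ^- l & D z <= 98 + tile_weight n l]) ->
  (area_integral (fun z => (D z)%:E) < +oo)%E.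
Proof.
move=> D0 hD; rewrite /area_integral.
apply: lte_mul_pinfty; rewrite ?lee_fin ?invr_ge0 ?pi_ge0//.
(* A measurable majorant on the whole plane: the constant 98 on a square containing the disc, plus
   the tiles of all nodes at all scales, one of which covers each exceptional point. *)
pose U p := (tile 98%R 0%R 1%R p + \sum_(0 <= n <oo) tiles n p)%E.
have S0 p : (0 <= \sum_(0 <= n <oo) tiles n p)%E.
  by apply: nneseries_ge0 => n _ _; exact: tiles_ge0.
have T0 p : (0 <= tile 98%R 0%R 1%R p)%E by rewrite tile_ge0.
apply: (@le_lt_trans _ _ (\int[plane_measure]_p U p)%E).
  apply: ge0_le_integral_dominated => [//|p _|p _|[x y] /= z1].
  - by rewrite lee_fin.
  - by rewrite adde_ge0.
  rewrite /U (tile_mem 98); last by apply: square_mem; rewrite subr0.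
  have [h|[n [l [l2 hl h]]]] := hD _ z1.
    by rewrite -[X in (X <= _)%E]adde0 leeD// lee_fin.
  apply: (@le_trans _ _ (98%:E + (tile_weight n l)%:E)%E); first by rewrite -EFinD lee_fin.
  rewrite leeD2l//; apply: le_trans (nneseries_ge_term n (fun i => tiles_ge0 i _)).
  rewrite /tiles (big_rem l); last by rewrite mem_iota leq0n add0n ltnS.
  rewrite tile_mem; last exact: square_mem.
  rewrite leeDl//; apply: sume_ge0 => i _; rewrite tile_ge0// tile_weight_ge0//.
rewrite /U ge0_integralD//; last 2 first.
- exact: measurable_tile.
- by apply: ge0_emeasurable_sum => [n p _ _|n _]; [exact: tiles_ge0|exact: measurable_tiles].
rewrite integral_tile// integral_nneseries//; last 2 first.
- by move=> n; exact: measurable_tiles.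
- by move=> n p _; exact: tiles_ge0.
apply: lte_add_pinfty; first exact: ltry.
apply: le_lt_trans (ltry (24 ^+ 3)); apply: nneseries_le => [n|n].
  by apply: integral_ge0 => p _; exact: tiles_ge0.
apply: (@le_trans _ _ (\sum_(0 <= i < n) (24 ^+ 3 * (theta R i ^+ 2 / (depth i)%:R))%:E)%E).
  by apply: lee_sum => i _; exact: integral_tiles.
by rewrite sumEFin lee_fin -mulr_sumr -[leRHS]mulr1 ler_wpM2l ?exprn_ge0// sum_theta_depth.
Qed.

End DirichletIntegral.

(** * Carleson sets and the divergent sum *)

Section CarlesonFailure.
Variable R : realType.

Lemma sum_at_most_one (u : nat -> R) (B : R) (N : nat) : 0 <= B ->
  (forall n, u n <= B) -> (forall i j, u i != 0 -> u j != 0 -> i = j) ->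
  \sum_(0 <= n < N) u n <= B.
Proof.
move=> B0 uB uniq; elim: N => [|N IH]; first by rewrite big_geq.
rewrite big_nat_recr//=; have [->|uN] := eqVneq (u N) 0; first by rewrite addr0.
rewrite big_nat big1 ?add0r// => i /andP[_ iN]; apply/eqP; apply: contraTT iN => ui.
by rewrite (uniq _ _ ui uN) ltnn.
Qed.

Definition turn : set R := `[0, 2 * pi]%classic.

Definition arc (n : nat) : set R := `]theta R n.+1, theta R n[%classic.

Lemma measurable_arc n : measurable (arc n).
Proof. exact: measurable_itv. Qed.

Lemma arc_disjoint t i j : arc i t -> arc j t -> i = j.
Proof.
rewrite /arc /= !in_itv /= => /andP[i1 i2] /andP[j1 j2].
have H k l : theta R k.+1 < t -> t < theta R l -> (l <= k)%N.
  move=> h1 h2; rewrite leqNgt; apply/negP => /(theta_decr R).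
  by rewrite leNgt (lt_trans h1 h2).
by apply/eqP; rewrite eqn_leq !H.
Qed.

Lemma arc_sub n : arc n `<=` turn.
Proof.
move=> t; rewrite /arc /turn /= !in_itv /= => /andP[t1 t2].
have := theta_gt0 R n.+1; have := theta_le1 R n; have := pi_ge2 R.
by move=> *; apply/andP; split; lra.
Qed.

Lemma turn_measure_lty : (@lebesgue_measure R turn < +oo)%E.
Proof. by rewrite /turn lebesgue_measure_itv /=; case: ifP => _; rewrite ?ltry// -EFinB ltry. Qed.

Lemma arc_measure n : @lebesgue_measure R (arc n) = (width R n)%:E.
Proof.
rewrite /arc lebesgue_measure_itv /= lte_fin ifT//.
by rewrite thetaS ltrBlDr ltrDl width_gt0.
Qed.

Lemma sum_le_esum (A : set nat) (u : nat -> R) (N : nat) : (forall n, 0 <= u n) ->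
  ((\sum_(0 <= n < N | n \in A) u n)%:E <= \esum_(n in A) (u n)%:E)%E.
Proof.
move=> u0; rewrite -[A in \esum_(n in A) _](_ : [set n | n \in A] = A); last first.
  by apply/seteqP; split => n /=; rewrite inE.
rewrite -nneseries_esum; last by move=> n _; rewrite lee_fin.
rewrite -sumEFin; apply: (@nneseries_lim_ge _ _ (fun n => n \in A)) => n _ _.
by rewrite lee_fin.
Qed.

(** * Lower bound for the Carleson integral *)

Section OneSet.
Variables (E : set R[i]) (C : set nat).
Hypothesis CE : (@node R) @` C `<=` E.
Hypothesis E_circle : E `<=` @circle R.

Let f (t : R) : \bar R := lne (edistC (cis t) E)^-1.

Lemma edistC_ge0 (z : R[i]) : (0 <= edistC z E)%E.
Proof. by apply: le_ereal_inf_tmp => _ [w _ <-]; rewrite lee_fin normc_ge0. Qed.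

Lemma le_lne_edist (z w : R[i]) (r : R) : E w -> normc (z - w) <= r -> 0 < r ->
  ((ln r^-1)%:E <= lne (edistC z E)^-1)%E.
Proof.
move=> Ew zr r0; rewrite -lne_EFin ?invr_gt0// lee_lne; last 2 first.
- by rewrite in_itv /= lee_fin invr_ge0 (ltW r0) leey.
- by rewrite in_itv /= inve_ge0 edistC_ge0 leey.
have -> : (r^-1)%:E = (r%:E)^-1%E by rewrite inver gt_eqF.
rewrite lee_pV2 ?inE ?edistC_ge0 ?lee_fin ?(ltW r0)//.
by apply: ge_ereal_inf; exists (normc (z - w))%:E; rewrite ?lee_fin//; exists w.
Qed.

Lemma arc_lower n t : C n -> arc n t -> ((ln (width R n)^-1)%:E <= f t)%E.
Proof.
move=> Cn; rewrite /arc /= in_itv /= => /andP[t1 t2].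
apply: (@le_lne_edist _ (node R n)); last exact: width_gt0.
  by apply: CE; exists n.
apply: le_trans (normc_cisB_le _ _) _; rewrite distrC gtr0_norm; last by lra.
by move: t1; rewrite thetaS; lra.
Qed.

(** Distances on the circle are at most 2, so the integrand is at least - ln 2. With a finite
    negative part, finiteness of the integral controls the positive part. *)
Lemma funeneg_carleson_lt : E !=set0 ->
  (\int[@lebesgue_measure R]_(t in turn) f^\- t < +oo)%E.
Proof.
move=> [w Ew].
have hneg t : (f^\- t <= (ln 2)%:E)%E.
  rewrite funenegE; have : ((ln 2^-1)%:E <= f t)%E.
    apply: (le_lne_edist Ew) => //; apply: le_trans (ler_normcB _ _) _.
    by rewrite normc_cis (E_circle Ew); lra.
  rewrite lnV ?posrE// EFinN leeNl => h.
  by rewrite ge_max h lee_fin ln_ge0// ler1n.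
apply: (@le_lt_trans _ _ (\int[@lebesgue_measure R]_(t in turn) (cst (ln 2)%:E) t)%E).
  apply: ge0_le_integral_dominated => // t _; rewrite ?funeneg_ge0//.
  by rewrite lee_fin ln_ge0// ler1n.
rewrite integral_cst; last exact: measurable_itv.
apply: lte_mul_pinfty => //.
  by rewrite lee_fin ln_ge0// ler1n.
exact: turn_measure_lty.
Qed.

Definition wgt n : R := if n \in C then ln (width R n)^-1 else 0.

Lemma ln_width_ge0 n : 0 <= ln (width R n)^-1.
Proof.
apply: ln_ge0; rewrite invf_ge1 ?width_gt0//; apply: le_trans (width_le R n) _.
by rewrite invf_le1 ?ltr0n// ler1n.
Qed.

Lemma wgt_ge0 n : 0 <= wgt n.
Proof. by rewrite /wgt; case: ifP => // _; exact: ln_width_ge0. Qed.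

(** The arcs are disjoint, so at most one term is nonzero, and [arc_lower] bounds that one. *)
Lemma sum_arcs_le t N : (\sum_(0 <= n < N) (wgt n * \1_(arc n) t)%:E <= f^\+ t)%E.
Proof.
rewrite sumEFin.
have f0 : (0 <= f^\+ t)%E := funepos_ge0 f t.
have [[n [Cn tn]]|no] := pselect (exists n, C n /\ arc n t).
  apply: (@le_trans _ _ (ln (width R n)^-1)%:E); last first.
    by rewrite funeposE le_max arc_lower.
  rewrite lee_fin; apply: sum_at_most_one; first exact: ln_width_ge0.
    move=> i; rewrite indicE; have [ti|ti] := boolP (t \in arc i); last first.
      by rewrite mulr0 ln_width_ge0.
    move: ti; rewrite inE => ti; rewrite (arc_disjoint ti tn) mulr1 /wgt.
    by rewrite mem_set.
  move=> i j; rewrite !indicE; have [|_] := boolP (t \in arc i); last by rewrite mulr0 eqxx.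
  rewrite inE => ti _; have [|_] := boolP (t \in arc j); last by rewrite mulr0 eqxx.
  by rewrite inE => tj _; exact: arc_disjoint ti tj.
rewrite big1// => n _; rewrite /wgt; case: ifPn => [|_]; last by rewrite mul0r.
rewrite inE => Cn; rewrite indicE memNset ?mulr0// => tn.
by apply: no; exists n.
Qed.

Lemma sum_arcs_integral N : 
  ((\sum_(0 <= n < N) wgt n * width R n)%:E <=
     \int[@lebesgue_measure R]_(t in turn) f^\+ t)%E.
Proof.
have mI : measurable turn by exact: measurable_itv.
have mw n : measurable_fun turn
    (fun t => (wgt n * \1_(arc n) t)%:E : \bar R).
  apply/measurable_EFinP; apply: measurable_funM; first exact: measurable_cst.
  by apply: measurable_funTS; apply: measurable_indic; exact: measurable_arc.
have w0 n t : (0 <= (wgt n * \1_(arc n) t)%:E)%E by rewrite lee_fin mulr_ge0// wgt_ge0.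
apply: (@le_trans _ _ (\int[@lebesgue_measure R]_(t in turn)
    (\sum_(0 <= n < N) (wgt n * \1_(arc n) t)%:E))%E); last first.
  apply: ge0_le_integral_dominated => // t _; last exact: sum_arcs_le.
  - by apply: sume_ge0 => n _.
rewrite ge0_integral_sum//.
rewrite -sumEFin; apply: lee_sum => n _.
under eq_integral do rewrite EFinM.
have mA := measurable_arc n.
rewrite ge0_integralZl_EFin ?wgt_ge0//; last first.
  by apply/measurable_EFinP; apply: measurable_funTS; exact: measurable_indic.
rewrite EFinM lee_wpmul2l ?lee_fin ?wgt_ge0// integral_indic//.
rewrite setIidl; last exact: arc_sub.
by rewrite (_ : (_ (arc n)) = (width R n)%:E)//; exact: arc_measure.
Qed.

Lemma carleson_sum_bounded :
  (circle_integral (fun z => lne (edistC z E)^-1) < +oo)%E ->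
  exists B : R, forall N, \sum_(0 <= n < N) wgt n * width R n <= B.
Proof.
(* For empty [C] all weights vanish; this case is separate because [E] may then be empty too. *)
move=> hE; have [[n Cn]|no] := pselect (C !=set0); last first.
  exists 0 => N; rewrite big1// => n _; rewrite /wgt memNset ?mul0r// => Cn.
  by apply: no; exists n.
have E0 : E !=set0 by exists (node R n); apply: CE; exists n.
have hneg := funeneg_carleson_lt E0.
set I := (\int[@lebesgue_measure R]_(t in turn) f^\+ t)%E.
have I0 : (0 <= I)%E by apply: integral_ge0.
have Ifin : (I < +oo)%E.
  (* An infinite positive part minus the finite negative part [J] would be +oo. *)
  move: hE; rewrite /circle_integral -/turn integralE -/f -/I.
  set J := (\int[_]_(_ in _) _)%E in hneg *.
  have J0 : (0 <= J)%E by apply: integral_ge0.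
  by case: (I) I0 => [i||]//; rewrite ?ltry//; case: J J0 hneg.
exists (fine I) => N; rewrite -lee_fin fineK ?ge0_fin_numE//.
exact: sum_arcs_integral.
Qed.

End OneSet.

Lemma no_carleson_split : ~ exists C : set nat,
  (exists2 E : set R[i], Carleson_set E & (@node R) @` C `<=` E) /\
  (\esum_(n in ~` C) ((ln (1 + (coef R n)^-1))^-1)%:E < +oo)%E.
Proof.
move=> [C [[E [_ Ec Eint] CE] hC]].
have [B hB] := carleson_sum_bounded CE Ec Eint.
have k1 : 1 <= 512 :> R by lra.
have cost n := coef_cost R n; move: k1 cost; move: (512 : R) => k k1 cost.
have k0 : 0 < k by lra.
pose u n : R := (ln (1 + (coef R n)^-1))^-1.
have u0 n : 0 <= u n.
  apply: le_trans (cost n); rewrite mulr_ge0 ?invr_ge0 ?(ltW k0)//.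
  by rewrite divr_ge0 ?(ltW (lgstep_gt0 R n)) ?(ltW (lg_gt0 R n.+1)).
have [B' hB'] : exists B' : R, forall N, \sum_(0 <= n < N | n \in ~` C) u n <= B'.
  exists (fine (\esum_(n in ~` C) (u n)%:E)) => N.
  rewrite -lee_fin fineK; first exact: sum_le_esum.
  by rewrite ge0_fin_numE// esum_ge0// => n _; rewrite lee_fin.
have [N hN] := sum_lgstep_unbounded (k * (B + B') : R).
have : \sum_(0 <= n < N) lgstep R n / lg R n.+1 <=
    k * (\sum_(0 <= n < N) wgt C n * width R n + \sum_(0 <= n < N | n \in ~` C) u n).
  rewrite [X in _ * (_ + X)]big_mkcond -big_split /= mulr_sumr.
  (* Termwise, the summand is paid for by the Carleson integral when [n] is in [C], and by the cost
     of the mass otherwise. *)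
  apply: ler_sum => n _.
  rewrite /wgt in_setC; have [nC|nC] /= := boolP (n \in C).
    rewrite addr0; have := width_ln_ge R n; rewrite [width R n * _]mulrC => h.
    by apply: le_trans h _; rewrite ler_peMl ?mulr_ge0 ?ln_width_ge0 ?(ltW (width_gt0 R n)).
  rewrite mul0r add0r -ler_pdivrMl//; exact: cost.
have h : \sum_(0 <= n < N) wgt C n * width R n + \sum_(0 <= n < N | n \in ~` C) u n
    <= B + B' by rewrite lerD.
move/le_trans/(_ (ler_wpM2l (ltW k0) h)) => /(lt_le_trans hN).
by rewrite ltxx.
Qed.

End CarlesonFailure.

(** * The atomic measure and its potential *)

Section BorelPlane.
Variable R : realType.

Lemma nbhs_normc (w : R[i]) (P : set R[i]) (e : R) : 0 < e ->
  (forall v, normc (v - w) < e -> P v) -> nbhs w P.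
Proof.
move=> e0 h; apply/nbhs_normP; exists e%:C; first by rewrite /= ltcR.
move=> v /=; rewrite /ball_ /= normc_normr ltcR normc_subC; exact: h.
Qed.

Lemma open_normc (U : set R[i]) :
  (forall w, U w -> exists2 e : R, 0 < e & forall v, normc (v - w) < e -> U v) -> open U.
Proof.
move=> h; rewrite openE => w /h[e e0 he]; exact: nbhs_normc he.
Qed.

Lemma open_measurableC (U : set (borelC R)) : open (U : set R[i]) -> measurable U.
Proof. exact: sub_gen_smallest. Qed.

Lemma measurable_circle : measurable (@circle R : set (borelC R)).
Proof.
rewrite -[circle (R:=R)]setCK; apply: measurableC; apply: open_measurableC.
apply: open_normc => w /= /eqP w1; exists `|normc w - 1|.
  by rewrite normr_gt0 subr_eq0.
move=> v vw v1; move: vw; rewrite -v1 => h.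
have h1 := lerB_normc w v; have h2 := lerB_normc v w.
have : `|normc w - normc v| <= normc (v - w).
  by rewrite ler_norml; rewrite normc_subC in h1; apply/andP; split; lra.
by rewrite leNgt h.
Qed.

Lemma measurable_point (w : R[i]) : measurable ([set w] : set (borelC R)).
Proof.
rewrite -[[set w]]setCK; apply: measurableC; apply: open_measurableC.
apply: open_normc => v /= /eqP vw; exists (normc (w - v)).
  by rewrite normc_gt0 subr_eq0 eq_sym.
by move=> x xv; apply/eqP; apply: contraTneq xv => ->; rewrite ltxx.
Qed.

(** Preimages of open rays are open in [U]. Continuity is local to [U] because the Herglotz kernel
    has a pole inside the disc. *)
Lemma measurable_fun_continuous_on (U : set R[i]) (D : set (borelC R)) (g : borelC R -> R) :
  open U -> measurable D -> D `<=` U ->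
  (forall w, U w -> forall e : R, 0 < e ->
     exists2 d : R, 0 < d & forall v, normc (v - w) < d -> `|g v - g w| < e) ->
  measurable_fun D g.
Proof.
move=> oU mD DU cg.
apply: (measurability (@RGenOInfty.G R)); first exact: RGenOInfty.measurableE.
move=> _ [_ [x ->] <-].
rewrite (_ : D `&` _ = D `&` (U `&` g @^-1` `]x, +oo[%classic)); last first.
  apply/seteqP; split => w /= [Dw]; first by move=> h; do ?split => //; exact: DU.
  by case.
apply: measurableI => //; apply: open_measurableC.
rewrite openE => w [Uw]; rewrite /= in_itv /= andbT => xg.
apply: filterI; first by move: oU; rewrite openE; exact.
have e0 : 0 < g w - x by rewrite subr_gt0.
have [d d0 hd] := cg w Uw _ e0; apply: (nbhs_normc d0) => v /hd.
by rewrite /= in_itv /= andbT ltr_norml => /andP[]; lra.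
Qed.

End BorelPlane.

(** * Integration against the atomic measure *)

Section AtomicMeasure.
Variable R : realType.

Definition atom (n : nat) : {measure set (borelC R) -> \bar R} :=
  mscale (NngNum (ltW (coef_gt0 R n))) (@dirac _ (borelC R) (node R n) R).

Definition atomic : set (borelC R) -> \bar R := mseries atom 0.

HB.instance Definition _ := Measure.copy atomic (mseries atom 0).

Lemma atomicE (A : set (borelC R)) :
  atomic A = (\sum_(0 <= n <oo) (coef R n)%:E * \d_(node R n : borelC R) A)%E.
Proof. by []. Qed.

Lemma coef_series_le : (\sum_(0 <= n <oo) (coef R n)%:E <= (2^-1)%:E)%E.
Proof.
apply: nneseries_le => n; first by rewrite lee_fin ltW// coef_gt0.
by rewrite sumEFin lee_fin sum_coef.
Qed.

Lemma dirac_le1 (w : borelC R) (A : set (borelC R)) : (\d_w A <= 1 :> \bar R)%E.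
Proof. by rewrite diracE lee_fin lern1 leq_b1. Qed.

Lemma atomic_fin : fin_num_fun atomic.
Proof.
move=> A mA; rewrite ge0_fin_numE//; apply: le_lt_trans (ltry 2^-1).
apply: le_trans coef_series_le; apply: lee_nneseries => [n _ _|n _].
  by rewrite mule_ge0// lee_fin ltW// coef_gt0.
change ((coef R n)%:E * \d_(node R n : borelC R) A <= (coef R n)%:E)%E.
by rewrite -[leRHS]mule1 lee_wpmul2l ?dirac_le1// lee_fin ltW// coef_gt0.
Qed.

HB.instance Definition _ := @Measure_isFinite.Build _ _ _ atomic atomic_fin.

Lemma node_circle n : (@circle R) (node R n).
Proof. exact: normc_node. Qed.

Lemma integral_atom n (h : borelC R -> \bar R) :
  measurable_fun (@circle R : set (borelC R)) h ->
  (forall w, (@circle R) w -> (0 <= h w)%E) ->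
  (\int[atom n]_(w in (@circle R : set (borelC R))) h w = (coef R n)%:E * h (node R n))%E.
Proof.
move=> mh h0; have mc := @measurable_circle R.
rewrite ge0_integral_mscale// integral_dirac// diracE mem_set ?mul1e//.
exact: node_circle.
Qed.

Lemma integral_atomic (h : borelC R -> \bar R) :
  measurable_fun (@circle R : set (borelC R)) h ->
  (forall w, (@circle R) w -> (0 <= h w)%E) ->
  (\int[atomic]_(w in (@circle R : set (borelC R))) h w =
    \sum_(0 <= n <oo) (coef R n)%:E * h (node R n))%E.
Proof.
move=> mh h0; rewrite ge0_integral_measure_series//; last exact: measurable_circle.
by apply: eq_eseriesr => n _; exact: integral_atom.
Qed.

Lemma integral_atomic_cvg (h : borelC R -> R) (K : R) :
  measurable_fun (@circle R : set (borelC R)) h ->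
  (forall w, 0 <= h w) -> (forall w, (@circle R) w -> h w <= K) ->
  (\int[atomic]_(w in (@circle R : set (borelC R))) (h w)%:E)%E \is a fin_num /\
  (fun N => \sum_(0 <= n < N) coef R n * h (node R n)) @ \oo -->
    fine (\int[atomic]_(w in (@circle R : set (borelC R))) (h w)%:E)%E.
Proof.
move=> mh h0 hK; have c0 n := ltW (coef_gt0 R n).
have K0 : 0 <= K by apply: le_trans (h0 (node R 0)) (hK _ (node_circle 0)).
rewrite integral_atomic//; last 2 first.
- exact/measurable_EFinP.
- by move=> w _; rewrite lee_fin.
have u0 n : (0 <= (coef R n)%:E * (h (node R n))%:E)%E by rewrite -EFinM lee_fin mulr_ge0.
set S := (\sum_(0 <= n <oo) _)%E.
have S0 : (0 <= S)%E by exact: nneseries_ge0.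
have Sfin : S \is a fin_num.
  rewrite ge0_fin_numE//; apply: le_lt_trans (ltry (2^-1 * K)).
  apply: nneseries_le => // n.
  apply: (@le_trans _ _ (\sum_(0 <= i < n) coef R i * K)%:E).
    rewrite -sumEFin; apply: lee_sum => i _.
    by rewrite -EFinM lee_fin ler_wpM2l// hK//; exact: node_circle.
  by rewrite lee_fin -mulr_suml ler_wpM2r// sum_coef.
split => //.
have : (fun n => \sum_(0 <= i < n) (coef R i)%:E * (h (node R i))%:E)%E @ \oo --> S.
  by apply: is_cvg_nneseries => n _ _.
rewrite -{1}(fineK Sfin) => /fine_cvgP[_].
apply: cvg_trans; apply: near_eq_cvg; apply: nearW => N /=.
by under eq_bigr do rewrite -EFinM; rewrite sumEFin.
Qed.

(** Split [g] into positive and negative parts; the bound [K] makes both integrals finite, so their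
    limits can be subtracted. *)
Lemma Rintegral_atomic_cvg (g : borelC R -> R) (K : R) :
  measurable_fun (@circle R : set (borelC R)) g ->
  (forall w, (@circle R) w -> `|g w| <= K) ->
  (fun N => \sum_(0 <= n < N) coef R n * g (node R n)) @ \oo -->
    (\int[atomic]_(w in (@circle R : set (borelC R))) g w).
Proof.
move=> mg gK.
have K0 : 0 <= K by apply: le_trans (gK _ (node_circle 0)).
have [fp cp] : (\int[atomic]_(w in (@circle R : set (borelC R))) (g^\+ w)%:E)%E \is a fin_num /\
    (fun N => \sum_(0 <= n < N) coef R n * g^\+ (node R n)) @ \oo -->
      fine (\int[atomic]_(w in (@circle R : set (borelC R))) (g^\+ w)%:E)%E.
  apply: (@integral_atomic_cvg _ K); first exact: measurable_funrpos.
    by move=> w; exact: funrpos_ge0.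
  by move=> w /gK h; rewrite /funrpos ge_max K0 andbT (le_trans (ler_norm _)).
have [fn cn] : (\int[atomic]_(w in (@circle R : set (borelC R))) (g^\- w)%:E)%E \is a fin_num /\
    (fun N => \sum_(0 <= n < N) coef R n * g^\- (node R n)) @ \oo -->
      fine (\int[atomic]_(w in (@circle R : set (borelC R))) (g^\- w)%:E)%E.
  apply: (@integral_atomic_cvg _ K); first exact: measurable_funrneg.
    by move=> w; exact: funrneg_ge0.
  by move=> w /gK h; rewrite /funrneg ge_max K0 andbT (le_trans (ler_norm _))// normrN.
rewrite /Rintegral integralE.
rewrite (_ : (fun w => (g w)%:E) = EFin \o g)// funerpos funerneg fineB//.
apply: cvg_trans (cvgB cp cn); apply: near_eq_cvg; apply: nearW => N.
change (\sum_(0 <= n < N) coef R n * g^\+ (node R n) -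
  \sum_(0 <= n < N) coef R n * g^\- (node R n) = \sum_(0 <= n < N) coef R n * g (node R n)).
rewrite -sumrB; apply: eq_bigr => n _; rewrite -mulrBr; congr (_ * _).
by have := congr1 (fun f => f (node R n)) (funrposBneg g).
Qed.

End AtomicMeasure.

(** * The Herglotz kernel and the potential of the measure *)

Section Poisson.
Variable R : realType.
Implicit Types (z w : R[i]).

Definition herglotz z w : R[i] := (w + z) / (w - z).

Lemma herglotzE z w : w != z -> herglotz z w = 1 + 2 * z * (w - z)^-1.
Proof. by move=> wz; rewrite /herglotz; field; rewrite subr_eq0. Qed.

Lemma herglotz_diff z w v (d : R) : 0 < d -> d <= normc (w - z) -> d <= normc (v - z) ->
  normc (herglotz z v - herglotz z w) <= 2 * normc z / d ^+ 2 * normc (v - w).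
Proof.
move=> d0 dw dv.
have neq x : d <= normc (x - z) -> x != z.
  by move=> h; rewrite -subr_eq0 -normc_gt0 (lt_le_trans d0).
rewrite !herglotzE ?neq// (_ : _ - _ = 2 * z * ((v - z)^-1 - (w - z)^-1)); last by ring.
rewrite normcM normcM normc2 -!mulrA ler_wpM2l// ler_wpM2l ?normc_ge0//.
apply: le_trans (normc_invB d0 dw dv) _.
by rewrite opprB addrA subrK mulrC.
Qed.

Lemma herglotz_continuous z w (e : R) : w != z -> 0 < e ->
  exists2 d : R, 0 < d & forall v, normc (v - w) < d ->
    normc (herglotz z v - herglotz z w) < e.
Proof.
move=> wz e0; set r := normc (w - z) / 2.
have r0 : 0 < r by rewrite divr_gt0// normc_gt0 subr_eq0.
have k0 : 0 <= 2 * normc z / r ^+ 2.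
  by rewrite divr_ge0 ?exprn_ge0 ?(ltW r0)// mulr_ge0// normc_ge0.
have k1 : 0 < 2 * normc z / r ^+ 2 + 1 by rewrite ltr_wpDl.
exists (Num.min r (e / (2 * normc z / r ^+ 2 + 1))); first by rewrite lt_min r0 divr_gt0.
move=> v; rewrite lt_min => /andP[vr ve].
have hw : r <= normc (w - z) by rewrite /r; have := normc_ge0 (w - z); lra.
have hv : r <= normc (v - z).
  have := ler_normc_dist v w z; rewrite [normc (w - v)]normc_subC.
  by move: vr; rewrite /r; lra.
apply: le_lt_trans (herglotz_diff r0 hw hv) _.
move: ve; rewrite ltr_pdivlMr// mulrC; apply: le_lt_trans.
by rewrite ler_wpM2r ?normc_ge0// lerDl.
Qed.

Lemma herglotz_bound z w : disc z -> (@circle R) w ->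
  normc (herglotz z w) <= 2 / (1 - normc z).
Proof.
rewrite /disc /circle /= => z1 w1.
have h1 := ler_normcD w z; have h2 := lerB_normc w z; rewrite w1 in h1 h2.
have d0 : 0 < 1 - normc z by lra.
rewrite /herglotz normcM normcV; apply: ler_pM; rewrite ?invr_ge0 ?normc_ge0//.
  by lra.
by rewrite lef_pV2 ?posrE//; lra.
Qed.

(** [p] stands for the real or the imaginary part. *)
Lemma measurable_herglotz (p : R[i] -> R) z : disc z ->
  (forall x y, `|p x - p y| <= normc (x - y)) ->
  measurable_fun (@circle R : set (borelC R)) (fun w : borelC R => p (herglotz z w)).
Proof.
move=> z1 hp; apply: (@measurable_fun_continuous_on _ [set w | w != z]).
- apply: open_normc => w /= wz; exists (normc (w - z)).
    by rewrite normc_gt0 subr_eq0.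
  by move=> v; rewrite normc_subC; apply: contraTneq => ->; rewrite ltxx.
- exact: measurable_circle.
- by move=> w cw /=; apply: contraTneq z1 => <-; rewrite /disc /= cw ltxx.
move=> w wz e e0; have [d d0 hd] := herglotz_continuous wz e0.
by exists d => // v /hd; apply: le_lt_trans; exact: hp.
Qed.

Lemma Re_lipschitz (x y : R[i]) : `|complex.Re x - complex.Re y| <= normc (x - y).
Proof. by apply: le_trans (ler_normc_Re _); case: x y => [a b] [c d]. Qed.

Lemma Im_lipschitz (x y : R[i]) : `|complex.Im x - complex.Im y| <= normc (x - y).
Proof. by apply: le_trans (ler_normc_Im _); case: x y => [a b] [c d]. Qed.

(** The body repeats the integral in [singular_inner], so that [singular_inner] at [z] is
    [cexp (- atomic_potential z)] by unfolding. *)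
Definition atomic_potential z : R[i] := cintegral (@atomic R) (@circle R)
  (fun w : borelC R => ((w : R[i]) + z) / ((w : R[i]) - z)).

Lemma potential_termE n z : disc z ->
  potential_term n z = (coef R n)%:C * herglotz z (node R n).
Proof.
move=> z1; have n0 : node R n != 0 by rewrite -normc_gt0 normc_node.
have nz : node R n - z != 0.
  rewrite subr_eq0; apply/eqP => e; have : normc z < 1 := z1.
  by rewrite -e normc_node ltxx.
rewrite /potential_term /herglotz /gapn /gap /pole; congr (_ * _); field.
by rewrite n0 nz.
Qed.

Lemma potential_clim z : disc z -> clim ((@potential R) ^~ z) (atomic_potential z).
Proof.
move=> z1; apply: clim_ReIm => /=.
  have := @Rintegral_atomic_cvg R (fun w : borelC R => complex.Re (herglotz z w)) (2 / (1 - normc z))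
    (measurable_herglotz z1 Re_lipschitz) (fun w cw => le_trans (ler_normc_Re _) (herglotz_bound z1 cw)).
  apply: cvg_trans; apply: near_eq_cvg; apply: nearW => N.
  rewrite /potential Re_sum; apply: eq_bigr => n _; rewrite potential_termE//.
  by case: (herglotz _ _) => a b /=; rewrite mul0r subr0.
have := @Rintegral_atomic_cvg R (fun w : borelC R => complex.Im (herglotz z w)) (2 / (1 - normc z))
  (measurable_herglotz z1 Im_lipschitz) (fun w cw => le_trans (ler_normc_Im _) (herglotz_bound z1 cw)).
apply: cvg_trans; apply: near_eq_cvg; apply: nearW => N.
rewrite /potential Im_sum; apply: eq_bigr => n _; rewrite potential_termE//.
by case: (herglotz _ _) => a b /=; rewrite mul0r addr0.
Qed.

End Poisson.

(** * Radial limits and membership in the Dirichlet space *)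

Section RadialLimits.
Variable R : realType.
Implicit Types (z w u : R[i]) (t : R).

(** Here |exp u| <= 1, and |exp x - 1| <= |x| + 8 |x|^2 <= 5 |x| for |x| <= 1/2. *)
Lemma cexp_near u v (d : R) : complex.Re u <= 0 -> normc (v - u) <= d -> d <= 2^-1 ->
  normc (cexp v - cexp u) <= 5 * d.
Proof.
move=> u0 vd d2; set x := v - u in vd; have x0 := normc_ge0 x.
have -> : v = u + x by rewrite /x addrCA subrr addr0.
rewrite cexpD (_ : _ - _ = cexp u * ((cexp x - 1 - x) + x)); last by ring.
rewrite normcM normc_cexp; apply: (@le_trans _ _ (normc ((cexp x - 1 - x) + x))).
  by rewrite ler_piMl ?normc_ge0// -expR0 ler_expR.
apply: le_trans (ler_normcD _ _) _.
have := cexp_quadratic (le_trans vd d2).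
by move: (normc (cexp x - 1 - x)) => y; nra.
Qed.

Lemma normc_radial (r t : R) : 0 <= r -> normc (r%:C * cis t) = r.
Proof. by move=> r0; rewrite normcM normc_real normc_cis mulr1 ger0_norm. Qed.

Lemma radial_dist (r t : R) : r <= 1 -> normc (cis t - r%:C * cis t) = 1 - r.
Proof.
move=> r1; rewrite -{1}[cis t]mul1r -mulrBl normcM normc_cis mulr1.
rewrite (_ : 1 - r%:C = (1 - r)%:C); last by rewrite rmorphB rmorph1.
by rewrite normc_real ger0_norm// subr_ge0.
Qed.

(** Both d - (1 - r) and 1 - r bound the gap at the radial point from below, hence so does their
    mean. *)
Lemma radial_gap_ge (r t d : R) n : 0 <= r -> r <= 1 ->
  d <= normc (gapn n (cis t)) -> d / 2 <= normc (gapn n (r%:C * cis t)).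
Proof.
move=> r0 r1; rewrite !normc_gapn => hd.
have h1 := ler_normc_dist (r%:C * cis t) (cis t) (node R n).
rewrite radial_dist// in h1.
have h2 := lerB_normc (node R n) (r%:C * cis t).
by rewrite normc_node normc_radial// [normc (node R n - _)]normc_subC in h2; lra.
Qed.

(** On the circle |1 - w| = 1, so the Poisson kernel vanishes away from its pole. *)
Lemma Re_potential_term_cis n t : gapn n (cis t) != 0 ->
  complex.Re (potential_term n (cis t)) = 0.
Proof.
set w := gapn n (cis t) => w0.
have hz : normc (1 - w) ^+ 2 = 1.
  by rewrite /w /gapn /gap subKr normcM normc_pole mul1r normc_cis expr1n.
have n0 : complex.Re w ^+ 2 + complex.Im w ^+ 2 != 0.
  by rewrite -normc_sqr expf_neq0// normc_eq0.
rewrite /potential_term -/w; move: hz n0; rewrite normc_sqr.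
clearbody w; case: w {w0} => x y /= hz n0.
rewrite !(mul0r, mulr0, subr0, addr0, oppr0).
have -> : 2 * (x / (x ^+ 2 + y ^+ 2)) - 1 = (1 - ((1 - x) ^+ 2 + y ^+ 2)) / (x ^+ 2 + y ^+ 2).
  by field.
by move: hz; rewrite sub0r sqrrN => ->; rewrite subrr mul0r mulr0.
Qed.

(** * Radial limits in a direction at positive distance from the nodes *)

Section Direction.
Variables (t d : R).
Hypotheses (d0 : 0 < d) (hd : forall n, d <= normc (gapn n (cis t))).

Lemma potential_cis_clim : exists l, clim ((@potential R) ^~ (cis t)) l.
Proof.
apply: (@clim_of_summable_increments _ _ (fun n => coef R n * (2 / d + 1)) (2^-1 * (2 / d + 1))).
  move=> n; rewrite /potential big_nat_recr//= addrAC subrr add0r /potential_term.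
  rewrite normcM normc_coef ler_wpM2l ?(ltW (coef_gt0 R n))//.
  apply: le_trans (ler_normcB _ _) _; rewrite normc1 lerD2r normcM normc2 ler_wpM2l//.
  by rewrite normc_inv_le.
move=> n; rewrite -mulr_suml ler_wpM2r ?sum_coef//.
by rewrite addr_ge0// divr_ge0// ltW.
Qed.

Lemma Re_potential_cis_limit l : clim ((@potential R) ^~ (cis t)) l -> complex.Re l = 0.
Proof.
move=> hl; have h N : complex.Re (potential N (cis t)) = 0.
  rewrite Re_sum big1// => n _; apply: Re_potential_term_cis.
  by rewrite -normc_eq0 gt_eqF// (lt_le_trans d0).
apply/eqP; rewrite eq_le; apply/andP; split.
  by apply: (clim_Re_le hl) => N; rewrite h.
have : complex.Re (- l) <= 0.
  apply: (clim_Re_le (climN hl)) => N.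
  by have := h N; case: (potential N (cis t)) => x y /= ->; rewrite oppr0.
by case: (l) => x y /=; rewrite oppr_le0.
Qed.

(** All gaps along the radius are at least d / 2, so the terms are Lipschitz up to the boundary,
    with constants summable thanks to the masses. *)
Lemma potential_radial (r : R) l : 0 <= r -> r < 1 ->
  clim ((@potential R) ^~ (cis t)) l ->
  normc (atomic_potential (r%:C * cis t) - l) <= 4 / d ^+ 2 * (1 - r).
Proof.
move=> r0 r1 hl; set z := r%:C * cis t.
have z1 : disc z by change (normc z < 1); rewrite normc_radial.
apply: (@clim_normc_le _ (fun N => potential N z - potential N (cis t)) _ _ 0).
  by apply: climB => //; exact: potential_clim.
move=> N _; rewrite /potential -sumrB; apply: le_trans (ler_normc_sum _ _ _) _.
apply: (@le_trans _ _ (\sum_(0 <= n < N) coef R n * (2 * ((1 - r) / (d / 2) ^+ 2)))).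
  apply: ler_sum => n _; rewrite /potential_term.
  rewrite (_ : _ - _ = (coef R n)%:C * (2 * ((gapn n z)^-1 - (gapn n (cis t))^-1))); last by ring.
  rewrite normcM normcM normc_coef normc2 ler_wpM2l ?(ltW (coef_gt0 R n))// ler_wpM2l//.
  have hz := radial_gap_ge r0 (ltW r1) (hd n).
  have ht : d / 2 <= normc (gapn n (cis t)).
    by apply: le_trans (hd n); have := d0; lra.
  have d2 : 0 < d / 2 by rewrite divr_gt0.
  apply: le_trans (normc_invB d2 ht hz) _.
  rewrite (_ : gapn n z - gapn n (cis t) = pole R n * (cis t - z)); last by rewrite /gapn /gap; ring.
  by rewrite normcM normc_pole mul1r radial_dist// ltW.
rewrite -mulr_suml.
have -> : 4 / d ^+ 2 * (1 - r) = 2^-1 * (2 * ((1 - r) / (d / 2) ^+ 2)).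
  by field; rewrite gt_eqF.
rewrite ler_wpM2r ?sum_coef//; apply: mulr_ge0 => //.
by apply: divr_ge0; [lra|exact: sqr_ge0].
Qed.

Lemma inner_radial_limit : exists l : R[i], normc l = 1 /\
  (fun r : R => cexp (- atomic_potential (r%:C * cis t))) @ (1 : R)^'- --> l.
Proof.
have [m hm] := potential_cis_clim; have m0 := Re_potential_cis_limit hm.
exists (cexp (- m)); split.
  by rewrite normc_cexp; case: (m) m0 => x y /= ->; rewrite oppr0 expR0.
set K := 4 / d ^+ 2; have K0 : 0 < K by rewrite divr_gt0// exprn_gt0.
apply/cvgrPdist_lt => e; rewrite ltcE => /andP[/eqP ie re].
have eE : e = (complex.Re e)%:C by move: ie; case: (e) => x y /= ->.
(* The first bound keeps K (1 - r) below 1/2, as [cexp_near] requires; the second makes its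
   conclusion smaller than the tolerance. *)
pose q := Num.min (K^-1 * 2^-1) ((5 * K)^-1 * complex.Re e).
have K5 : 0 < 5 * K by rewrite mulr_gt0.
have q0 : 0 < q by rewrite lt_min; apply/andP; split; rewrite mulr_gt0 ?invr_gt0.
near=> r.
have r0 : 0 <= r by near: r; apply: nbhs_left_ge.
have r1 : r < 1 by near: r; exact: nbhs_left_lt.
have rq : 1 - r < q by near: r; exact: nbhs_left_ltBl.
rewrite normc_normr eE ltcR normc_subC.
have h := potential_radial r0 r1 hm; rewrite -/K in h.
move: rq; rewrite lt_min => /andP[q1 q2].
rewrite ltr_pdivlMl// in q1; rewrite ltr_pdivlMl// in q2.
apply: le_lt_trans (_ : 5 * (K * (1 - r)) < _); last by rewrite mulrA.
apply: cexp_near; last exact: ltW.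
  by case: (m) m0 => x y /= ->; rewrite oppr0.
by rewrite -opprD normc_opp.
Unshelve. all: by end_near. Qed.

End Direction.

(** The nodes accumulate only at 1: those close to 1 are far from [cis t], and the finitely many
    others are treated one by one. *)
Lemma gap_lower_bound t : cis t != 1 -> (forall n, cis t != node R n) ->
  exists2 d : R, 0 < d & forall n, d <= normc (gapn n (cis t)).
Proof.
move=> t1 tn; set a := normc (cis t - 1).
have a0 : 0 < a by rewrite normc_gt0 subr_eq0.
have [N hN] := @theta_small R (a / 2) (divr_gt0 a0 (ltr0n _ 2)).
have far n : (N <= n)%N -> a / 2 <= normc (gapn n (cis t)).
  move=> /hN hn; rewrite normc_gapn.
  apply: (@le_trans _ _ (a - theta R n)); first by move: hn; lra.
  rewrite lerBlDr; apply: le_trans (ler_normc_dist (node R n) _ _) _.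
  by rewrite lerD2l node_near1.
have near : exists2 d : R, 0 < d & forall n, (n < N)%N -> d <= normc (gapn n (cis t)).
  elim: N {hN far} => [|N [d d0 hd]]; first by exists 1.
  exists (Num.min d (normc (gapn N (cis t)))).
    by rewrite lt_min d0 normc_gapn normc_gt0 subr_eq0 tn.
  move=> n; rewrite ltnS leq_eqVlt => /predU1P[->|/hd h]; first by rewrite ge_min lexx orbT.
  by rewrite ge_min h.
have [d d0 hd] := near; exists (Num.min d (a / 2)); first by rewrite lt_min d0 divr_gt0.
move=> n; have [nN|nN] := ltnP n N; first by rewrite ge_min hd.
by rewrite ge_min far// orbT.
Qed.

Lemma cis_eq_small (x y : R) : cis x = cis y -> `|x - y| < 2 * pi -> x = y.
Proof.
move=> e xy.
have h : `|sin ((x - y) / 2)| = 0.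
  by have := normc_cisB x y; rewrite e subrr normc0; lra.
apply/eqP; rewrite -subr_eq0; apply/eqP.
have s0 : sin ((x - y) / 2) = 0 by apply/eqP; rewrite -normr_eq0 h.
move: xy; rewrite ltr_norml => /andP[h1 h2].
have [lt0|gt0|//] := ltgtP (x - y) 0.
- have := @sin_gt0_pi R (- ((x - y) / 2)); rewrite sinN s0 oppr0 ltxx => H.
  by exfalso; suff : false by []; apply: H; apply/andP; split; lra.
- have := @sin_gt0_pi R ((x - y) / 2); rewrite s0 ltxx => H.
  by exfalso; suff : false by []; apply: H; apply/andP; split; lra.
Qed.

(** Two points of a fiber with the same integer part of t / (2 pi) are less than 2 pi apart, hence
    equal; that integer part is therefore injective on the fiber. *)
Lemma countable_cis_fiber w : countable [set t : R | cis t = w].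
Proof.
apply/countable_injP; exists (fun t => pickle (Num.floor (t / (2 * pi)))).
move=> x y; rewrite !inE /= => xw yw /(pcan_inj pickleK) e.
have p0 : 0 < 2 * pi :> R by rewrite mulr_gt0 ?pi_gt0.
apply: cis_eq_small; first by rewrite xw yw.
have /andP[x1 x2] := floor_itv (x / (2 * pi)).
have /andP[y1 y2] := floor_itv (y / (2 * pi)).
rewrite -e in y1 y2; move: x1 x2 y1 y2; rewrite intrD.
rewrite !ler_pdivlMr// !ltr_pdivrMr//; move: (_%:~R) => k x1 x2 y1 y2.
by rewrite ltr_norml; apply/andP; split; lra.
Qed.

(* The arguments of [1], the only limit point of the nodes, and of the nodes. *)
Definition exceptional : set R :=
  \bigcup_n [set t | cis t = if n is k.+1 then node R k else 1].

Lemma countable_exceptional : countable exceptional.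
Proof.
by apply: bigcup_countable => // n _; exact: countable_cis_fiber.
Qed.

Lemma radial_limits_ae : {ae @lebesgue_measure R, forall t : R, exists l : R[i],
  normc l = 1 /\ (fun r : R => cexp (- atomic_potential (r%:C * cis t))) @ (1 : R)^'- --> l}.
Proof.
exists exceptional; split.
- by apply: countable_measurable; [exact: measurable_set1|exact: countable_exceptional].
- exact: countable_lebesgue_measure0 countable_exceptional.
move=> t /=; apply: contra_notP => te.
have t1 : cis t != 1 by apply/eqP => h; apply: te; exists 0%N.
have tn n : cis t != node R n by apply/eqP => h; apply: te; exists n.+1.
by have [d d0 hd] := gap_lower_bound t1 tn; exact: inner_radial_limit hd.
Qed.

Lemma inner_atomic : inner (singular_inner (@atomic R)).
Proof.
split.
- move=> z z1; have [q [h _]] := inner_part_expands (@potential_clim R) z1.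
  exact: expands_derivable h.
- by move=> z z1; have := inner_part_le1 (@potential_clim R) z1.
- exact: radial_limits_ae.
Qed.

Lemma Hardy2_outer_part : Hardy2 (@outer_part R).
Proof.
split; first by move=> z z1; have [q [h _]] := outer_part_expands z1; exact: expands_derivable h.
apply: (@le_lt_trans _ _ (((2 * pi)^-1)%:E * (4%:E * @lebesgue_measure R (@turn R)))%E).
  apply: ge_ereal_sup => _ [r /= /andP[r0 r1] <-].
  rewrite lee_wpmul2l ?lee_fin ?invr_ge0 ?mulr_ge0 ?pi_ge0//.
  rewrite -(integral_cst (@lebesgue_measure R)); last exact: measurable_itv.
  rewrite /circle_integral; apply: ge0_le_integral_dominated => // t _.
  - by rewrite lee_fin sqr_ge0.
  - by rewrite lee_fin.
  have h : normc (outer_part (r%:C * cis t)) <= 2.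
    by apply: outer_part_le2; change (normc (r%:C * cis t) < 1); rewrite normc_radial.
  rewrite lee_fin; apply: (@le_trans _ _ (2 ^+ 2)); last by rewrite -natrX.
  by rewrite lerXn2r ?nnegrE ?normc_ge0.
apply: lte_mul_pinfty => //; first by rewrite lee_fin invr_ge0 mulr_ge0 ?pi_ge0.
by apply: lte_mul_pinfty => //; exact: turn_measure_lty.
Qed.

Lemma Dirichlet_product : Dirichlet (fun z => singular_inner (@atomic R) z * outer_part z).
Proof.
have ex z : disc z -> exists q, expands (fun z => singular_inner (@atomic R) z * outer_part z) z q.
  by move=> z1; have [q [h _]] := product_expands (@potential_clim R) z1; exists q.
split; first by move=> z /ex[q]; exact: expands_derivable.
apply: area_integral_lty => z; first exact: sqr_ge0.
move=> z1; have [q hq] := ex z z1; rewrite (expands_derive1 hq).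
have := product_derive_bound (@potential_clim R) z1 hq.
case=> [h|[n [l [l2 hl h]]]]; [by left|right; exists n, l; split => //].
by rewrite -normc_gapn.
Qed.

Lemma factor_atomic : factor_of_Dirichlet (singular_inner (@atomic R)).
Proof.
split; first exact: inner_atomic.
exists (@outer_part R); split; [exact: Hardy2_outer_part|exact: Dirichlet_product|].
exists 0; first by change (normc (0 : R[i]) < 1); rewrite normc0.
rewrite /outer_part subr0 mul1r; apply: mulf_neq0; last by rewrite mulf_neq0 ?bprod_inf0_neq0.
by rewrite -normc_gt0 /singular_inner normc_cexp expR_gt0.
Qed.

Lemma singular_atomic : singular_on_circle (@atomic R).
Proof.
have zero (A : set (borelC R)) : (forall n, ~ A (node R n)) -> atomic A = 0%E.
  move=> h; rewrite atomicE eseries0// => n _ _.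
  by rewrite diracE memNset ?mule0.
split; first by apply: zero => n; apply; exact: node_circle.
(* The nodes themselves carry the measure, and their arguments form a countable set. *)
exists (range (@node R)); split.
- by apply: countable_measurable; [exact: measurable_point|exact: card_image_le].
- by apply: zero => n; apply; exists n.
apply: countable_lebesgue_measure0.
apply: (@sub_countable _ _ _ exceptional); last exact: countable_exceptional.
apply: subset_card_le => t [_ [n _ h]]; by exists n.+1.
Qed.

End RadialLimits.

Theorem theorem9p2 (R : realType) :
  exists (mu : {finite_measure set (borelC R) -> \bar R})
         (c : nat -> R) (tau : nat -> R[i]),
    [/\ (forall n, 0 < c n) /\ (\sum_(0 <= n <oo) (c n)%:E < +oo)%E,
        (forall n, circle (tau n)) /\ injective tau,
        (forall A : set (borelC R), measurable A ->
           mu A = (\sum_(0 <= n <oo) (c n)%:E * \d_(tau n : borelC R) A)%E) /\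
        singular_on_circle mu,
        factor_of_Dirichlet (singular_inner mu) &
        ~ exists C : set nat,
            (exists2 E : set R[i], Carleson_set E & tau @` C `<=` E) /\
            (\esum_(n in ~` C) ((ln (1 + (c n)^-1))^-1)%:E < +oo)%E].
Proof.
exists (@atomic R), (coef R), (node R); split.
- by split; [exact: coef_gt0|exact: le_lt_trans (coef_series_le R) (ltry _)].
- by split; [exact: node_circle|exact: node_inj].
- by split; [move=> A _; exact: atomicE|exact: singular_atomic].
- exact: factor_atomic.
- exact: no_carleson_split.
Qed.
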